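(* Let $n\in\mathbb{N}$ and let $\mathbf w=(w_1,\dots,w_n)\in(\mathbb{Q}\cap(0,1))^n$ be the normalized weight system of a quasihomogeneous singularity, i.e. satisfying condition $(C1)$. Write $w_j=s_j/t_j$ with $\gcd(s_j,t_j)=1$, $D_{\mathbf w}=\prod_{j=1}^n\left(\frac1{s_j}\Lambda_{t_j}-\Lambda_1\right)=\sum_{m\in\mathbb{N}}\nu(m)\Psi_m$ (with $\nu(m)\in\mathbb{N}_0$), $\nu_{max}=\max_m\nu(m)$, and $M_j=\{m\in\mathbb{N}\mid\nu(m)\ge j\}$ for $j=1,\dots,\nu_{max}$. Suppose that one of the following holds: (i) $\mathbf w$ is of cycle type; (ii) $\mathbf w$ is of chain type; (iii) $n=2$; (iv) $n=3$ and $\mathbf w$ is of type III, IV, V, VI or VII. Then each of the sets $M_1,\dots,M_{\nu_{max}}$ satisfies condition (I). In fact, each $M_j$ satisfies the stronger conditions: (1) $M_j$ contains a largest number $m_1$ and every vertex of $\mathcal{G}(M_j)$ can be reached from $m_1$ by a directed path; (2) there is a directed path in $\mathcal{G}(M_j)$ consisting only of $2$-edges which contains a vertex of every $2$-plane of $\mathcal{G}(M_j)$.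
   Context: Condition $(C1)$ for $\mathbf w$, with $N=\{1,\dots,n\}$: for every nonempty $J\subset N$, either there is $\alpha\in\mathbb{N}_0^n$ with $\alpha_i=0$ for $i\notin J$ and $\sum_i\alpha_iw_i=1$, or there is $K\subset N\setminus J$ with $|K|=|J|$ such that for each $k\in K$ there is $\alpha\in\mathbb{N}_0^n$ with $\alpha_i=0$ for $i\notin J$ and $\sum_i\alpha_iw_i=1-w_k$. (This is equivalent to the existence of a quasihomogeneous polynomial of these weights with an isolated singularity at $0$; then $D_{\mathbf w}$ is the divisor of the characteristic polynomial of the monodromy, whence $\nu(m)\in\mathbb{N}_0$ and the $M_j$ are the supports of its elementary divisors.) Here $\mathbb{Q}\langle S^{UR}\rangle$ is the group ring over $\mathbb{Q}$ of the group of roots of unity, $\Lambda_m=\sum_{a=0}^{m-1}\langle e^{2\pi ia/m}\rangle$, $\Psi_m=\sum_{\zeta\text{ of order }m}\langle\zeta\rangle$. Types (all up to permutation of the variables, with $a_j\in\mathbb{N}$): cycle type: $a_jw_j+w_{j-1}=1$ for all $j$ with $w_0:=w_n$; chain type: $a_1w_1=1$ and $a_jw_j+w_{j-1}=1$ for $j=2,\dots,n$. For $n=3$: type III: $a_1w_1=1$, $a_2w_2+w_1=1$, $a_3w_3+w_1=1$; type IV: $a_1w_1=1$, $a_2w_2+w_3=1$, $a_3w_3+w_2=1$; type V: chain type; type VI: $a_1w_1+w_2=1$, $a_2w_2+w_1=1$, $a_3w_3+w_1=1$; type VII: cycle type. Graph: for finite $M\subset\mathbb{N}$, $\mathcal{G}(M)$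 has vertex set $M$ and a directed edge from $m_1$ to $m_2$ (a $p$-edge) iff $m_1/m_2=p^e$ for a prime $p$, $e\ge1$, and no $m_3\in M\setminus\{m_1,m_2\}$ satisfies $m_2\mid m_3\mid m_1$. The $p$-planes are the connected components after deleting all $p$-edges; a highest $p$-plane is one at none of whose vertices a $p$-edge ends; a highest $p$-edge is a $p$-edge from $m_1$ to $m_2$ such that no $p$-edge ends at $m_1$. Condition (I): $\mathcal{G}(M)$ is connected; the graph obtained from $\mathcal{G}(M)$ by deleting all highest $2$-edges has only one or two connected components; and for every prime $p\ge3$, $\mathcal{G}(M)$ has only one highest $p$-plane. *)

(* Defs.v *)
From HB Require Import structures.
From mathcomp Require Import all_boot all_order all_algebra all_fingroup.
From Stdlib Require Import Relations.
Set Implicit Arguments. Unset Strict Implicit. Unset Printing Implicit Defensive.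
Import Order.TTheory GRing.Theory Num.Theory.
Local Open Scope ring_scope.

Section Weights.
Variable n : nat.
Implicit Type w : 'I_n -> rat.

Definition weight_range w := forall i, 0 < w i < 1.

Definition supported_on (J : {set 'I_n}) (al : 'I_n -> nat) :=
  forall i, i \notin J -> al i = 0%N.

Definition wsum w (al : 'I_n -> nat) : rat := \sum_i (al i)%:R * w i.

Definition C1 w := forall J : {set 'I_n}, J != set0 ->
  (exists al, supported_on J al /\ wsum w al = 1) \/
  (exists K : {set 'I_n}, K \subset ~: J /\ #|K| = #|J| /\
     forall k, k \in K -> exists al, supported_on J al /\ wsum w al = 1 - w k).

Definition wnum w (j : 'I_n) : nat := absz (numq (w j)).
Definition wden w (j : 'I_n) : nat := absz (denq (w j)).

(* Group ring.  All roots of unity occurring lie in mu_L with           *)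
(* L = prod_j t_j, so we compute in Q<mu_L> = Q[Z/L]: an element is a   *)
(* coefficient function c |-> coefficient of e^{2 pi i c/L} (read mod L)*)
Definition wL w : nat := (\prod_(j < n) wden w j)%N.

Definition gr_mul (L : nat) (f g : nat -> rat) : nat -> rat :=
  fun c => \sum_(a < L) \sum_(b < L)
              (if ((a + b) %% L == c %% L)%N then f a * g b else 0).

(* Lambda_t = sum of all t-th roots of unity = multiples of L/t in Z/L *)
Definition Lambda (L t : nat) : nat -> rat :=
  fun c => if (L %/ t %| c %% L)%N then 1 else 0.

Definition Dfactor w (j : 'I_n) : nat -> rat :=
  fun c => ((wnum w j)%:R)^-1 * Lambda (wL w) (wden w j) c - Lambda (wL w) 1 c.

Definition Dw w : nat -> rat :=
  \big[gr_mul (wL w) / Lambda (wL w) 1]_(j < n) Dfactor w j.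

(* nu(m) = coefficient of <e^{2 pi i/m}> in D_w (D_w = sum nu(m) Psi_m);  *)
(* e^{2 pi i/m} is the element L/m of Z/L; no element of order m if m∤L *)
Definition nu w (m : nat) : rat :=
  if (0 < m)%N && (m %| wL w)%N then Dw w (wL w %/ m)%N else 0.

Definition numax w : rat := \big[Num.max/0]_(m <- divisors (wL w)) nu w m.

Definition Mset w (j : nat) : seq nat :=
  [seq m <- divisors (wL w) | j%:R <= nu w m].

Definition cycle_type w := exists (s : {perm 'I_n}) (a : 'I_n -> nat),
  (forall j, 0 < a j)%N /\
  forall i j : 'I_n, (i.+1 %% n)%N = j -> (a j)%:R * w (s j) + w (s i) = 1.

Definition chain_type w := exists (s : {perm 'I_n}) (a : 'I_n -> nat),
  (forall j, 0 < a j)%N /\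
  (forall j : 'I_n, val j = 0%N -> (a j)%:R * w (s j) = 1) /\
  forall i j : 'I_n, (i.+1)%N = j -> (a j)%:R * w (s j) + w (s i) = 1.

Definition wn (v : 'I_n -> rat) (k : nat) : rat :=
  match (insub k : option 'I_n) with Some i => v i | None => 0 end.

Definition typeIII w := exists (s : {perm 'I_n}) (a1 a2 a3 : nat),
  let v := wn (fun i => w (s i)) in
  [/\ (0 < a1)%N && (0 < a2)%N && (0 < a3)%N,
      a1%:R * v 0%N = 1, a2%:R * v 1%N + v 0%N = 1
    & a3%:R * v 2%N + v 0%N = 1].

Definition typeIV w := exists (s : {perm 'I_n}) (a1 a2 a3 : nat),
  let v := wn (fun i => w (s i)) in
  [/\ (0 < a1)%N && (0 < a2)%N && (0 < a3)%N,
      a1%:R * v 0%N = 1, a2%:R * v 1%N + v 2%N = 1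
    & a3%:R * v 2%N + v 1%N = 1].

Definition typeV w := chain_type w.

Definition typeVI w := exists (s : {perm 'I_n}) (a1 a2 a3 : nat),
  let v := wn (fun i => w (s i)) in
  [/\ (0 < a1)%N && (0 < a2)%N && (0 < a3)%N,
      a1%:R * v 0%N + v 1%N = 1, a2%:R * v 1%N + v 0%N = 1
    & a3%:R * v 2%N + v 0%N = 1].

Definition typeVII w := cycle_type w.

End Weights.

Section Graph.
Variable M : seq nat.

Definition pedge (p m1 m2 : nat) : Prop :=
  prime p /\ m1 \in M /\ m2 \in M /\
  (exists e, (1 <= e)%N /\ m1 = (m2 * p ^ e)%N) /\
  ~ (exists m3, m3 \in M /\ m3 <> m1 /\ m3 <> m2 /\ (m2 %| m3)%N /\ (m3 %| m1)%N).

Definition gedge (m1 m2 : nat) : Prop := exists p, pedge p m1 m2.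

Definition sym_conn (R : nat -> nat -> Prop) : nat -> nat -> Prop :=
  clos_refl_trans nat (fun x y => R x y \/ R y x).

Definition graph_connected : Prop :=
  forall x y, x \in M -> y \in M -> sym_conn gedge x y.

Definition highest_pedge (p m1 m2 : nat) : Prop :=
  pedge p m1 m2 /\ ~ (exists m0, pedge p m0 m1).

Definition edge_no_high2 (m1 m2 : nat) : Prop :=
  gedge m1 m2 /\ ~ highest_pedge 2 m1 m2.

Definition one_or_two_components_no_high2 : Prop :=
  exists a b, a \in M /\ b \in M /\
    forall x, x \in M -> sym_conn edge_no_high2 x a \/ sym_conn edge_no_high2 x b.

(* p-planes: components of G(M) minus all p-edges *)
Definition edge_no_p (p m1 m2 : nat) : Prop := gedge m1 m2 /\ ~ pedge p m1 m2.
Definition pconn (p : nat) : nat -> nat -> Prop := sym_conn (edge_no_p p).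

Definition highest_pplane (p x : nat) : Prop :=
  forall y, pconn p x y -> ~ (exists z, pedge p z y).

Definition unique_highest_pplane (p : nat) : Prop :=
  exists x, x \in M /\ highest_pplane p x /\
    forall y, y \in M -> highest_pplane p y -> pconn p x y.

Definition condI : Prop :=
  [/\ graph_connected, one_or_two_components_no_high2
    & forall p, prime p -> (3 <= p)%N -> unique_highest_pplane p].

Definition strong1 : Prop :=
  exists m1, m1 \in M /\ (forall m, m \in M -> m <= m1)%N /\
    forall v, v \in M -> clos_refl_trans nat gedge m1 v.

Definition two_path (l : seq nat) : Prop :=
  l <> [::] /\ (forall v, v \in l -> v \in M) /\
  forall i, (i.+1 < size l)%N -> pedge 2 (nth 0%N l i) (nth 0%N l i.+1).

Definition strong2 : Prop :=
  exists l, two_path l /\ forall x, x \in M -> exists v, v \in l /\ pconn 2 x v.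

End Graph.

(* Main.v *)
Require Import Defs.
From HB Require Import structures.
From mathcomp Require Import all_boot all_order all_algebra all_fingroup.
From mathcomp Require Import zify ring lra.
From Stdlib Require Import Relations FunctionalExtensionality.
Set Implicit Arguments. Unset Strict Implicit. Unset Printing Implicit Defensive.
Import Order.TTheory GRing.Theory Num.Theory.
Local Open Scope ring_scope.

(** In each of the listed cases [D_w] is a short combination of the [Lambda_t]:
    alternating along a chain of divisors for chain type, [c Lambda_t +- Lambda_1]
    for cycle type, and at most five terms otherwise.  Its superlevel sets [M_j]
    are then obtained from a set closed under passing to multiples inside the
    divisors of some [T] by repeatedly adding a layer
    [{m : m | L, ~ m | g}], where the previous set lies in the divisors of [g] and
    [g | L].  Sets of this kind are reachable from their largest element, and
    their [2]-planes all meet one geometric progression [c 2^e] with [c] odd: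
    adding a layer in which the odd part of [L] does not divide [g] gives a new
    such [c], the odd part of [L]; otherwise the old [c] still works.
    Finally, condition (I) follows from (1) and (2): the only [p]-plane that can be
    highest is the one of the largest element, and only the first edge of the path
    of (2) can be a highest [2]-edge. *)

(** ** Reachability in sets of divisors *)

(* Unlike [pedge], a step may jump over intermediate vertices; this makes
   reachability monotone in the vertex set. *)
Definition pstep (P Q : pred nat) (x y : nat) : Prop :=
  [/\ P x, P y & exists q e, [/\ prime q, Q q & x = (y * q ^ e)%N]].

Definition reach (P : pred nat) := clos_refl_trans nat (pstep P predT).

(** Only odd primes are allowed, so related members of a vertex set end up in the same [2]-plane. *)
Definition oconn (P : pred nat) := clos_refl_sym_trans nat (pstep P odd).

(* The progression [c 2^e] is the [2]-path of condition (2). *)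
Definition spanned (P : pred nat) (T : nat) : Prop :=
  [/\ (0 < T)%N, P T, forall x, P x -> reach P T x
    & exists c, odd c /\
        forall x, P x -> exists e, P (c * 2 ^ e)%N /\ oconn P x (c * 2 ^ e)%N].

Definition layered (t : nat) (P : pred nat) : Prop :=
  P =1 pred0 \/ exists2 T, (T %| t)%N & spanned P T.

Lemma pstep_mono (P P' Q Q' : pred nat) x y :
  subpred P P' -> subpred Q Q' -> pstep P Q x y -> pstep P' Q' x y.
Proof.
move=> sP sQ [Px Py [q [e [qp Qq xE]]]].
by split; [exact: sP | exact: sP | exists q, e; split => //; exact: sQ].
Qed.

Lemma reach_mono (P P' : pred nat) x y :
  subpred P P' -> reach P x y -> reach P' x y.
Proof.
move=> sP; elim=> {x y} [x y xy | x | x y z _ IH1 _ IH2].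
- exact: rt_step (pstep_mono sP (fun _ => id) xy).
- exact: rt_refl.
- exact: rt_trans IH1 IH2.
Qed.

Lemma oconn_mono (P P' : pred nat) x y :
  subpred P P' -> oconn P x y -> oconn P' x y.
Proof.
move=> sP; elim=> {x y} [x y xy | x | x y _ | x y z _ IH1 _ IH2].
- exact: rst_step (pstep_mono sP (fun _ => id) xy).
- exact: rst_refl.
- exact: rst_sym.
- exact: rst_trans IH1 IH2.
Qed.

Lemma eq_spanned (P P' : pred nat) T : P =1 P' -> spanned P T -> spanned P' T.
Proof.
move=> eqP; have s1 : subpred P P' by move=> z; rewrite eqP.
case=> T0 PT rT [c [oc cP]]; split => //; first by rewrite -eqP.
  by move=> x; rewrite -eqP => /rT; apply: reach_mono.
exists c; split => // x; rewrite -eqP => /cP [e [Pe xe]]; exists e.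
by rewrite -eqP; split => //; apply: oconn_mono xe.
Qed.

Lemma eq_layered t (P P' : pred nat) : P =1 P' -> layered t P -> layered t P'.
Proof.
move=> eqP [P0 | [T Tt sP]]; first by left => x; rewrite -eqP.
by right; exists T => //; apply: eq_spanned sP.
Qed.

Lemma layered_dvd t u (P : pred nat) : (t %| u)%N -> layered t P -> layered u P.
Proof.
by move=> tu [P0 | [T Tt sP]]; [left | right; exists T => //; apply: dvdn_trans tu].
Qed.

(** The primes of [y %/ x] are stripped off one at a time; every intermediate number is a multiple
    of [x] dividing [y]. *)
Lemma climb (P Q : pred nat) x y :
    (0 < y)%N -> (x %| y)%N -> (forall z, (x %| z)%N -> (z %| y)%N -> P z) ->
    (forall q, prime q -> (q %| y %/ x)%N -> Q q) ->
  clos_refl_trans nat (pstep P Q) y x.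
Proof.
move=> y0 /dvdnP[k Dy]; rewrite {}Dy in y0 *.
move: y0; rewrite muln_gt0 => /andP[k0 x0]; rewrite mulnK //.
elim/ltn_ind: k k0 => k IH k0 Pz Qq.
have [k1 | k1] := leqP k 1.
  by have ->: k = 1%N; [lia | rewrite mul1n; apply: rt_refl].
have qp := pdiv_prime k1; have qk := pdiv_dvd k.
set q := pdiv k in qp qk; have q1 := prime_gt1 qp.
have kE := divnK qk; set k' := (k %/ q)%N in kE.
apply: rt_trans (IH k' _ _ _ _).
- apply: rt_step; split; first by apply: Pz => //; rewrite dvdn_mull.
    by apply: Pz; [rewrite dvdn_mull | rewrite -kE dvdn_mul // dvdn_mulr].
  by exists q, 1%N; split; rewrite ?expn1 //; [exact: Qq | rewrite -kE; lia].
- by nia.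
- by nia.
- by move=> z xz zk; apply: Pz => //; apply: dvdn_trans zk _; rewrite -kE dvdn_mul ?dvdn_mulr.
- by move=> r rp rk; apply: Qq => //; rewrite -kE dvdn_mulr.
Qed.

Lemma odd_partn2' x : odd (x`_2^')%N.
Proof.
by rewrite odd_2'nat part_pnat.
Qed.

Lemma partn2C x : (0 < x)%N -> (x`_2^' * 2 ^ logn 2 x)%N = x.
Proof. by move=> x0; rewrite -p_part mulnC partnC. Qed.

Lemma dvdn_oddM2 c e L : odd c -> (c * 2 ^ e %| L)%N = (c %| L)%N && (2 ^ e %| L)%N.
Proof. by move=> oc; rewrite Gauss_dvd // coprimeXr // coprimen2. Qed.

(** For [x %| L] this is the largest divisor of [L] that is an odd multiple of [x]. *)
Definition column (L x : nat) : nat := (L`_2^' * 2 ^ logn 2 x)%N.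

Lemma dvdn_column x L : (0 < L)%N -> (x %| L)%N -> (x %| column L x)%N && (column L x %| L)%N.
Proof.
move=> L0 xL; have x0 := dvdn_gt0 L0 xL; apply/andP; split.
  by rewrite -{1}(partn2C x0) dvdn_mul // partn_dvd.
by rewrite -{2}(partn2C L0) dvdn_mul // dvdn_exp2l // dvdn_leq_log.
Qed.

(** The quotient of [column L x] by [x] divides the odd part of [L], so [climb] uses odd primes
    only. *)
Lemma oconn_column (P : pred nat) x L :
    (0 < L)%N -> (x %| L)%N -> (forall z, (x %| z)%N -> (z %| L)%N -> P z) ->
  P (column L x) /\ oconn P x (column L x).
Proof.
move=> L0 xL up; have /andP[xc cL] := dvdn_column L0 xL.
split; first exact: up.
apply: rst_sym; apply: clos_rt_clos_rst; apply: climb => //.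
- exact: dvdn_gt0 cL.
- by move=> z xz zc; apply: up => //; apply: dvdn_trans cL.
move=> q qp qd; have x0 := dvdn_gt0 L0 xL.
have : (q %| L`_2^')%N.
  apply: dvdn_trans qd _; rewrite /column -{2}(partn2C x0) divnMr ?expn_gt0 //.
  have := partn_dvd (2%N)^' L0 xL => /dvdnP[k ->]; rewrite mulnK ?part_gt0 //.
  exact: dvdn_mulr.
by move/dvdn_odd; apply; apply: odd_partn2'.
Qed.

(** If such a set is nonempty it contains [L], from which [climb] reaches everything. The columns of
    its members are multiples of the odd part of [L] by powers of [2]. *)
Lemma layered_up L (P : pred nat) :
    (0 < L)%N -> (forall x, P x -> (x %| L)%N) ->
    (forall x y, P x -> (x %| y)%N -> (y %| L)%N -> P y) -> layered L P.
Proof.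
move=> L0 PL up; case PLE: (P L); last first.
  left => x; apply/negP => Px; move: (up x L Px (PL _ Px) (dvdnn _)).
  by rewrite PLE.
right; exists L => //; split => //.
  by move=> x Px; apply: climb; rewrite ?PL // => z; apply: up.
exists (L`_2^')%N; split => [|x Px]; first exact: odd_partn2'.
exists (logn 2 x); apply: oconn_column => //; first exact: PL.
by move=> z; apply: up.
Qed.

Lemma spanned_dvd P T x : spanned P T -> P x -> (x %| T)%N.
Proof.
case=> _ _ rT _ /rT; elim=> {x} // [x y [_ _ [q [e [_ _ ->]]]] | x y z _ h1 _ h2].
  exact: dvdn_mulr.
exact: dvdn_trans h1.
Qed.

Lemma lcmn_pexp q f x : prime q -> exists e, lcmn x (q ^ f) = (x * q ^ e)%N.
Proof.
move=> qp; have : (q ^ f %/ gcdn x (q ^ f) %| q ^ f)%N.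
  by rewrite dvdn_div // dvdn_gcdr.
move/(dvdn_pfactor _ _ qp) => [e _ eE]; exists e.
by rewrite -eE /lcmn muln_divA // dvdn_gcdr.
Qed.

Lemma ndvdn_prime_power a b : (0 < a)%N -> ~~ (a %| b)%N ->
  exists q f, [/\ prime q, (q %| a)%N, (q ^ f %| a)%N & ~~ (q ^ f %| b)%N].
Proof.
move=> a0 nab.
have [/hasP[q qa nq] | /hasPn all_q] :=
    boolP (has (fun q => ~~ (q ^ logn q a %| b)%N) (primes a)).
  exists q, (logn q a); split => //; move: qa; rewrite mem_primes.
  - by case/and3P.
  - by case/and3P.
  - by rewrite pfactor_dvdnn.
case/negP: nab; apply/dvdn_partP => // q qa; rewrite p_part.
by move: (all_q q qa); rewrite negbK.
Qed.

(** The layer is closed under multiples inside the divisors of [L], so [climb] handles it. What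
    remains is to enter [N] from the layer and to find one progression meeting all [2]-planes. *)
Lemma spanned_layer L g T (N : pred nat) :
    (0 < L)%N -> (g %| L)%N -> g != L -> (T %| g)%N -> spanned N T ->
  spanned [pred m | (m %| L)%N && ~~ (m %| g)%N || N m] L.
Proof.
move=> L0 gL gnL Tg sN; set P := [pred m | _].
have N_T x : N x -> (x %| T)%N := spanned_dvd sN.
have NP : subpred N P by move=> x Nx; rewrite /P /= Nx orbT.
have nLg : ~~ (L %| g)%N by apply: contra gnL => Lg; rewrite eqn_dvd gL.
have PL : P L by rewrite /P /= dvdnn nLg.
have TL := dvdn_trans Tg gL.
have [_ NT rT [c [oc cN]]] := sN.
have up x z : (x %| L)%N -> ~~ (x %| g)%N -> (x %| z)%N -> (z %| L)%N -> P z.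
  move=> xL xg xz zL; rewrite /P /= zL /=; apply/orP; left.
  by apply: contra xg; apply: dvdn_trans.
have upr x : (x %| L)%N -> ~~ (x %| g)%N -> reach P L x.
  by move=> xL xg; apply: climb => // z; apply: up.
(* The lcm of an old vertex with a prime power dividing [L] but not [g] lies in the layer and
   differs from that vertex by a power of a single prime. *)
have jump x q f : N x -> prime q -> (q ^ f %| L)%N -> ~~ (q ^ f %| g)%N ->
    exists2 y, [/\ (y %| L)%N, ~~ (y %| g)%N & (x %| y)%N]
             & forall Q : pred nat, Q q -> pstep P Q y x.
  move=> Nx qp qL qg; have [e De] := lcmn_pexp f x qp.
  have yL : (x * q ^ e %| L)%N by rewrite -De dvdn_lcm qL (dvdn_trans (N_T _ Nx)).
  have yg : ~~ (x * q ^ e %| g)%N by apply: contra qg; apply: dvdn_trans; rewrite -De dvdn_lcmr.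
  exists (x * q ^ e)%N => [|Q Qq]; first by split=> //; apply: dvdn_mulr.
  by split; [exact: (up _ _ yL yg (dvdnn _) yL) | apply: NP | exists q, e].
split => //.
  move=> x /orP[/andP[xL xg] | Nx]; first exact: upr.
  (* Entering [N] at its top [T] is enough, since [T] reaches all of [N]. *)
  have [q [f [qp _ qL qg]]] := ndvdn_prime_power L0 nLg.
  have [y [yL yg _] yx] := jump T q f NT qp qL qg.
  apply: rt_trans (upr _ yL yg) _; apply: rt_trans (reach_mono NP (rT x Nx)).
  exact/rt_step/yx.
have toc x : (x %| L)%N -> ~~ (x %| g)%N -> P (column L x) /\ oconn P x (column L x).
  by move=> xL xg; apply: oconn_column => // z; apply: up.
(* If the odd part of [L] does not divide [g], the jump can use an odd prime. Each old vertex then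
   shares its [2]-plane with a layer vertex, hence with a column. *)
have [cg | ncg] := boolP (L`_2^' %| g)%N; last first.
  exists (L`_2^')%N; split=> [|x]; first exact: odd_partn2'.
  case/orP=> [/andP[xL xg] | Nx]; first by exists (logn 2 x); apply: toc.
  have [q [f [qp qc qL qg]]] := ndvdn_prime_power (part_gt0 (2%N)^' L) ncg.
  have {}qL : (q ^ f %| L)%N := dvdn_trans qL (dvdn_part _ _).
  have [y [yL yg _] yx] := jump x q f Nx qp qL qg.
  have oq : odd q := dvdn_odd qc (odd_partn2' L).
  have [Pc yc] := toc y yL yg; exists (logn 2 y); split => //.
  by apply: rst_trans yc; apply/rst_sym/rst_step/yx.
(* Now the [2]-part of a layer vertex [x] fails to divide [g], as otherwise its column would divide
   [g]. So [c * 2 ^ logn 2 x] is also in the layer, and it has the same column as [x]. *)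
exists c; split => // x /orP[/andP[xL xg] | Nx]; last first.
  by have [e [Ne xe]] := cN x Nx; exists e; split; [apply: NP | apply: oconn_mono xe].
have [e0 [/N_T Tc _]] := cN T NT.
have {Tc} cg' : (c %| g)%N by apply: dvdn_trans Tg; apply: dvdn_trans Tc; apply: dvdn_mulr.
have x0 := dvdn_gt0 L0 xL.
have e2 : (2 ^ logn 2 x %| x)%N by rewrite pfactor_dvdnn.
have zL : (c * 2 ^ logn 2 x %| L)%N.
  by rewrite dvdn_oddM2 // (dvdn_trans cg' gL) (dvdn_trans e2 xL).
have zg : ~~ (c * 2 ^ logn 2 x %| g)%N.
  apply: contra xg; rewrite dvdn_oddM2 // => /andP[_ eg].
  have /andP[xc _] := dvdn_column L0 xL; apply: dvdn_trans xc _.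
  by rewrite dvdn_oddM2 ?odd_partn2' // cg eg.
exists (logn 2 x); split; first by apply: (up (c * 2 ^ logn 2 x)%N).
have [_ xc] := toc x xL xg; have [_ zc] := toc _ zL zg.
have c0 : (0 < c)%N by rewrite odd_gt0.
have lc : logn 2 c = 0%N by rewrite logn_coprime ?coprime2n.
apply: rst_trans xc _; apply: rst_sym; move: zc; rewrite /column.
by rewrite lognM ?expn_gt0 // pfactorK // lc.
Qed.

(** This is [spanned_layer] together with two degenerate cases: an empty layer, and an empty [N],
    where the layer alone is closed under multiples. *)
Lemma layered_layer L g (N : pred nat) :
  (0 < L)%N -> (g %| L)%N -> layered g N ->
  layered L [pred m | (m %| L)%N && ~~ (m %| g)%N || N m].
Proof.
move=> L0 gL sN; have [gE | gnL] := eqVneq g L.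
  by rewrite gE in sN *; apply: eq_layered sN => m /=; rewrite andbN.
case: sN => [N0 | [T Tg sN]]; last by right; exists L => //; apply: spanned_layer sN.
apply: layered_up => // [x | x y] /=; rewrite N0 orbF /=; first by case/andP.
case/andP=> _ xg xy yL; rewrite yL /=; apply/orP; left.
by apply: contra xg; apply: dvdn_trans.
Qed.

(** ** Graph conditions *)

Section Graph.
Variable M : seq nat.
Hypothesis M_gt0 : forall m, m \in M -> (0 < m)%N.

(** Numbers between [y] and [y * q ^ e] in the divisibility order are the [y * q ^ f]. If one with
    [0 < f < e] is a vertex, the step splits there; otherwise it is an edge. *)
Lemma pedge_path q x y e : prime q -> x \in M -> y \in M -> x = (y * q ^ e)%N ->
  clos_refl_trans nat (pedge M q) x y.
Proof.
move=> qp; elim/ltn_ind: e x y => e IH x y xM yM xE.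
have y0 := M_gt0 yM; have q1 := prime_gt1 qp; have q0 := prime_gt0 qp.
case: (posnP e) => [e0 | e0].
  by rewrite xE e0 muln1; apply: rt_refl.
have [/hasP[f] | /hasPn nof] := boolP (has (fun f => (y * q ^ f)%N \in M) (iota 1 e.-1)).
  rewrite mem_iota => /andP[f0 fe] fM.
  apply: rt_trans (IH (e - f)%N _ _ _ xM fM _) (IH f _ _ _ fM yM erefl); try lia.
  by rewrite xE -mulnA -expnD; congr (_ * _ ^ _)%N; lia.
apply: rt_step; split => //; split => //; split => //; split; first by exists e.
case=> m [mM [mx [my [/dvdnP[k mE] mdx]]]].
move: mdx; rewrite xE mE (mulnC y) dvdn_pmul2r // => /(dvdn_pfactor _ _ qp)[f fe kE].
have f0 : (0 < f)%N by case: (f) kE => // k1; case: my; rewrite mE k1 mul1n.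
have fe' : f != e by apply/eqP => fe'; case: mx; rewrite mE kE fe' xE mulnC.
have /nof/negP : f \in iota 1 e.-1 by rewrite mem_iota; lia.
by case; rewrite mulnC -kE -mE.
Qed.

Lemma pedge_gedge p x y : pedge M p x y -> gedge M x y.
Proof. by exists p. Qed.

Lemma pedge_mem p x y : pedge M p x y -> x \in M /\ y \in M.
Proof. by case=> _ [? [? _]]. Qed.

Lemma clos_rt_mono (R R' : nat -> nat -> Prop) x y :
  (forall a b, R a b -> R' a b) -> clos_refl_trans nat R x y -> clos_refl_trans nat R' x y.
Proof.
move=> sR; elim=> {x y} [x y xy | x | x y z _ IH1 _ IH2].
- exact/rt_step/sR.
- exact: rt_refl.
- exact: rt_trans IH1 IH2.
Qed.

Lemma sym_conn_sym R x y : sym_conn R x y -> sym_conn R y x.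
Proof.
elim=> {x y} [x y xy | x | x y z _ IH1 _ IH2].
- by apply: rt_step; case: xy; [right | left].
- exact: rt_refl.
- exact: rt_trans IH2 IH1.
Qed.

Lemma pedge_inj p q x y : pedge M p x y -> pedge M q x y -> p = q.
Proof.
case=> pp [xM [yM [[e [e1 xE]] _]]] [qp [_ [_ [[f [f1 xE']] _]]]].
have y0 := M_gt0 yM; have /eqP : (y * p ^ e = y * q ^ f)%N by rewrite -xE.
rewrite eqn_pmul2l // => /eqP pq.
have : (p %| q ^ f)%N by rewrite -pq dvdn_exp.
by rewrite Euclid_dvdX // dvdn_prime2 // => /andP[/eqP].
Qed.

(** A step by an odd prime refines to edges for that prime, none of which is a [2]-edge. *)
Lemma oconn_pconn (P : pred nat) x y :
  (forall m, P m -> m \in M) -> oconn P x y -> pconn M 2 x y.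
Proof.
move=> PM; elim=> {x y} [x y | x | x y _ | x y z _ IH1 _ IH2].
- case=> /PM xM /PM yM [q [e [qp oq xE]]].
  apply: clos_rt_mono (pedge_path qp xM yM xE) => a b ab; left.
  split; first exact: pedge_gedge ab.
  by move/(pedge_inj ab) => q2; rewrite q2 in oq.
- exact: rt_refl.
- exact: sym_conn_sym.
- exact: rt_trans IH1 IH2.
Qed.

(** The vertices [c * 2 ^ e] are listed downwards by prepending the one with the new largest
    exponent. The clause on [head] is the invariant showing that no vertex lies strictly between the
    new vertex and the previous head. *)
Lemma column_two_path c : (0 < c)%N -> forall k, exists l,
  [/\ forall v, v \in l <-> exists e, [/\ (e < k)%N, v = (c * 2 ^ e)%N & v \in M],
      forall v, v \in l -> (v %| head 0 l)%N
    & forall i, (i.+1 < size l)%N -> pedge M 2 (nth 0%N l i) (nth 0%N l i.+1)].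
Proof.
move=> c0; elim=> [|k [l [lP lh lp]]].
  by exists [::]; split => // v; split => // -[e []].
have lk v : v \in l -> (v %| c * 2 ^ k)%N.
  by move/lP=> [e [ek -> _]]; rewrite dvdn_pmul2l // dvdn_exp2l // ltnW.
have [kM | kM] := boolP ((c * 2 ^ k)%N \in M); last first.
  exists l; split => // v; rewrite lP; split=> -[e [ek vE vM]]; exists e; split => //.
    exact: ltnW.
  move: ek; rewrite ltnS leq_eqVlt => /orP[/eqP ek | //].
  by rewrite -ek -vE vM in kM.
exists (c * 2 ^ k :: l)%N; split.
- move=> v; rewrite inE; split=> [/orP[/eqP -> | /lP[e [ek vE vM]]] | [e [ek vE vM]]].
  + by exists k.
  + by exists e; split => //; apply: ltnW.
  + move: ek; rewrite ltnS leq_eqVlt => /orP[/eqP ek | ek]; first by rewrite vE ek eqxx.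
    by apply/orP; right; apply/lP; exists e.
- by move=> v; rewrite inE => /orP[/eqP -> //|]; apply: lk.
case=> [|i] /= il; last exact: lp.
case: l lP lh lp lk il => // h l lP lh lp lk _ /=.
have /lP[e [ek hE hM]] : h \in h :: l by rewrite mem_head.
split => //; split => //; split => //; split.
  exists (k - e)%N; split; first by rewrite subn_gt0.
  by rewrite hE -mulnA -expnD subnKC // ltnW.
case=> m [mM [mk [mh [hm /dvdnP[a aE]]]]].
have cm : (c %| m)%N by apply: dvdn_trans hm; rewrite hE dvdn_mulr.
case/dvdnP: cm => b bE; move: aE; rewrite bE => aE.
have : (b %| 2 ^ k)%N.
  by rewrite -(dvdn_pmul2r c0) (mulnC (2 ^ k)%N) aE dvdn_mull.
case/(dvdn_pfactor _ _ (isT : prime 2)) => f fk fE.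
have {}fk : (f < k)%N.
  rewrite ltn_neqAle fk andbT; apply/eqP => fk'; case: mk.
  by rewrite bE fE fk' mulnC.
have /lh /= mh' : m \in h :: l.
  by apply/lP; exists f; split => //; rewrite bE fE mulnC.
by case: mh; apply/eqP; rewrite eqn_dvd hm mh'.
Qed.

Lemma pconn_no_high2 x y : pconn M 2 x y -> sym_conn (edge_no_high2 M) x y.
Proof.
apply: clos_rt_mono => a b ab.
have noh2 u v : edge_no_p M 2 u v -> edge_no_high2 M u v.
  by case=> uv n2; split => // -[/n2].
by case: ab => /noh2; [left | right].
Qed.

Lemma strong2_components : strong2 M -> one_or_two_components_no_high2 M.
Proof.
case=> -[|a [|b l]] [[ln [lM lp]] lc] //.
  have aM : a \in M by apply: lM; rewrite mem_head.
  exists a, a; split => //; split => // x /lc[v []].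
  by rewrite inE => /eqP -> /pconn_no_high2; left.
(* Every edge after the first starts where its predecessor ends, so it is not highest. The path
   beyond [a] thus stays in the component of [b]. *)
have conn i : (i < size (b :: l))%N -> sym_conn (edge_no_high2 M) (nth 0%N (b :: l) i) b.
  elim: i => [|i IH] il; first exact: rt_refl.
  apply: rt_trans (IH (ltnW il)); apply: rt_step; right; split.
    exact: pedge_gedge (lp i.+1 il).
  by case=> _; apply; exists (nth 0%N (a :: b :: l) i); apply: lp (ltnW il).
exists a, b; split; first by apply: lM; rewrite mem_head.
split=> [|x /lc[v [vl /pconn_no_high2 xv]]]; first by apply: lM; rewrite !inE eqxx orbT.
move: vl; rewrite inE => /orP[/eqP <-|]; first by left.
by case/(nthP 0%N) => i /conn il vE; right; rewrite vE in il; apply: rt_trans il.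
Qed.

Lemma gedge_dvd x y : gedge M x y -> (y %| x)%N.
Proof. by case=> p [_ [_ [_ [[e [_ ->]] _]]]]; apply: dvdn_mulr. Qed.

Lemma edge_no_p_logn p x y : prime p -> edge_no_p M p x y -> logn p x = logn p y.
Proof.
move=> pp [[q xy] np]; have qp : p != q by apply/eqP => pq; case: np; rewrite pq.
case: xy => qq [xM [yM [[e [_ ->]] _]]].
have y0 := M_gt0 yM; rewrite lognM // ?expn_gt0 ?prime_gt0 // lognX (logn_prime _ qq).
by rewrite (negPf qp) muln0 addn0.
Qed.

Lemma pconn_logn p x y : prime p -> pconn M p x y -> logn p x = logn p y.
Proof.
move=> pp; elim=> {x y} [x y [] /(edge_no_p_logn pp) -> | | x y z _ -> _ ->] //.
Qed.

Lemma strong1_connected : strong1 M -> graph_connected M.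
Proof.
case=> m [mM [_ rm]] x y /rm mx /rm my.
have lft a b : gedge M a b -> gedge M a b \/ gedge M b a by left.
exact: rt_trans (sym_conn_sym (clos_rt_mono lft mx)) (clos_rt_mono lft my).
Qed.

(** Edges other than [p]-edges preserve [logn p], so a [p]-edge ending in the plane of [m] would
    start at a vertex of larger valuation than [m], though it divides [m]. Conversely, walking back
    from a vertex of a highest plane along a path from [m] never crosses a [p]-edge. *)
Lemma strong1_highest p : prime p -> strong1 M -> unique_highest_pplane M p.
Proof.
move=> pp [m [mM [_ rm]]]; exists m; split => //.
have dm x : x \in M -> (x %| m)%N.
  move/rm; elim=> {x} [x y /gedge_dvd | | x y z _ h1 _ h2] //.
  exact: dvdn_trans h2 h1.
split=> [y my [z zy] | y yM hy].
  have [zM yM] := pedge_mem zy; case: zy => _ [_ [_ [[e [e0 zE]] _]]].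
  have := dvdn_leq_log p (M_gt0 mM) (dm _ zM).
  have y0 := M_gt0 yM; rewrite zE lognM // ?expn_gt0 ?prime_gt0 // pfactorK // (pconn_logn pp my).
  by rewrite -{2}[logn p y]addn0 leq_add2l leqNgt e0.
have /clos_rt_rtn1_iff my := rm _ yM.
elim: my hy => [|u v uv _ IH] hv; first exact: rt_refl.
have nuv : ~ pedge M p u v by move=> uv'; apply: (hv v (rt_refl _ _ _)); exists u.
have {}uv : edge_no_p M p u v by [].
have vu : pconn M p v u by apply: rt_step; right.
apply: rt_trans (sym_conn_sym vu); apply: IH => y' uy'.
by apply: hv; apply: rt_trans uy'.
Qed.

Lemma spanned_conditions (P : pred nat) T :
  (forall m, (m \in M) = P m) -> spanned P T -> condI M /\ strong1 M /\ strong2 M.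
Proof.
move=> MP sP; have PM m : P m -> m \in M by rewrite MP.
have dT x : P x -> (x %| T)%N := spanned_dvd sP.
case: sP => T0 PT rT [c [oc cP]].
have s1 : strong1 M.
  exists T; split; first exact: PM.
  split=> [m | v]; rewrite MP; first by move/dT/dvdn_leq; apply.
  move/rT; elim=> {v} [x y | x | x y z _ h1 _ h2].
  - case=> /PM xM /PM yM [q [e [qp _ xE]]].
    apply: clos_rt_mono (pedge_path qp xM yM xE) => a b; exact: pedge_gedge.
  - exact: rt_refl.
  - exact: rt_trans h1 h2.
have s2 : strong2 M.
  have c0 : (0 < c)%N by rewrite odd_gt0.
  (* The bound [T] on the exponents suffices, because [e < 2 ^ e <= c * 2 ^ e <= T]. *)
  have [l [lP _ lp]] := column_two_path c0 T.
  have le e : P (c * 2 ^ e)%N -> (c * 2 ^ e)%N \in l.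
    move=> Pe; apply/lP; exists e; split; rewrite ?MP //.
    apply: leq_trans (dvdn_leq T0 (dT _ Pe)); apply: leq_trans (ltn_expl e (isT : 1 < 2)%N) _.
    by rewrite leq_pmull.
  exists l; split; first split.
  - by have [e [Pe _]] := cP T PT; move=> l0; have := le e Pe; rewrite l0.
  - by split => // v /lP[e []].
  - move=> x; rewrite MP => /cP[e [Pe xe]]; exists (c * 2 ^ e)%N; split; first exact: le.
    exact: oconn_pconn xe.
split => //; split; first exact: strong1_connected.
  exact: strong2_components.
by move=> p pp _; apply: strong1_highest.
Qed.

End Graph.

(** ** The group ring *)

Section GroupRing.
Variable l : nat.
Local Notation L := l.+1.

(** For [L = l.+1] the type ['I_L] is the group Z/L, and each [x] pairs with exactly one
    contributing index, [c - x]. *)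
Lemma gr_mulE (f g : nat -> rat) c :
  gr_mul L f g c = \sum_(x : 'I_L) f x * g ((inZp c - x)%R : 'I_L).
Proof.
rewrite /gr_mul; apply: eq_bigr => x _; rewrite -big_mkcond /=.
rewrite (big_pred1 (inZp c - x)) // => y.
rewrite -[RHS](inj_eq (addrI x)) [x + (inZp c - x)]addrC subrK.
by rewrite -[RHS](inj_eq val_inj).
Qed.

Lemma gr_mulC : commutative (gr_mul L).
Proof.
move=> f g; apply: functional_extensionality => c; rewrite !gr_mulE.
have inj : injective (fun x : 'I_L => inZp c - x) by move=> x y /addrI/oppr_inj.
rewrite (reindex_inj inj); apply: eq_bigr => x _.
by rewrite mulrC opprB [inZp c + _]addrC subrK.
Qed.

Lemma gr_mulA : associative (gr_mul L).
Proof.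
move=> f g h; apply: functional_extensionality => c; rewrite !gr_mulE.
under eq_bigr => x _ do rewrite gr_mulE mulr_sumr.
under [RHS]eq_bigr => x _ do rewrite gr_mulE mulr_suml.
rewrite [RHS]exchange_big; apply: eq_bigr => y _.
have inj : injective (fun x : 'I_L => x + y) by move=> x z /addIr.
rewrite [RHS](reindex_inj inj); apply: eq_bigr => x _.
by rewrite !valZpK mulrA addrK [x + y]addrC opprD addrA.
Qed.

(** Functions on [nat] need not be periodic, so [Lambda L 1] is not a unit for all of them. A
    commutative semigroup law is enough to reorder the factors of [D_w]. *)
HB.instance Definition _ := SemiGroup.isComLaw.Build (nat -> rat) (gr_mul L) gr_mulA gr_mulC.

Lemma dvdn_inZp d c : (d %| L)%N -> (d %| (inZp c : 'I_L))%N = (d %| c)%N.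
Proof. by move=> dL; rewrite /= /dvdn modn_dvdm. Qed.

Lemma dvdn_ZpN d (x : 'I_L) : (d %| L)%N -> (d %| (- x)%R)%N = (d %| x)%N.
Proof.
move=> dL; rewrite /= /dvdn modn_dvdm // -/(dvdn _ _) -/(dvdn _ _).
by rewrite dvdn_subr // ltnW.
Qed.

Lemma dvdn_ZpD d (x y : 'I_L) :
  (d %| L)%N -> (d %| x)%N -> (d %| (x + y)%R)%N = (d %| y)%N.
Proof. by move=> dL dx; rewrite /= /dvdn modn_dvdm // -/(dvdn _ _) dvdn_addr. Qed.

Lemma sum_dvdn d : (d %| L)%N -> \sum_(x < L) (d %| x)%:R = (L %/ d)%:R :> rat.
Proof.
move=> dL; rewrite divn_count_dvd -natr_sum big_add1 /= big_mkord; congr (_ %:R).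
(* The count runs over [1..L] and the sum over [0..L-1]; both [0] and [L] are multiples of [d]. *)
by rewrite [LHS]big_ord_recl [RHS]big_ord_recr /= dvdn0 dL addnC.
Qed.

(** On the divisors of [L], the map sending [x] to [L %/ x] reverses divisibility and therefore
    exchanges gcd and lcm. *)
Lemma codivisor_lcmn a b : (a %| L)%N -> (b %| L)%N ->
  gcdn (L %/ a) (L %/ b) = (L %/ lcmn a b)%N.
Proof.
move=> aL bL; have la : (0 < a)%N := dvdn_gt0 (ltn0Sn l) aL; have lb : (0 < b)%N := dvdn_gt0 (ltn0Sn l) bL.
have l0 : (0 < lcmn a b)%N by rewrite lcmn_gt0 la.
have lL : (lcmn a b %| L)%N by rewrite dvdn_lcm aL.
apply/eqP; rewrite eqn_dvd; apply/andP; split; last first.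
  rewrite dvdn_gcd; apply/andP; split.
    by rewrite -(dvdn_pmul2r l0) divnK // -{1}(divnK aL) dvdn_pmul2l ?dvdn_lcml // divn_gt0 // dvdn_leq.
  by rewrite -(dvdn_pmul2r l0) divnK // -{1}(divnK bL) dvdn_pmul2l ?dvdn_lcmr // divn_gt0 // dvdn_leq.
have gL x : (x %| L)%N -> (gcdn (L %/ a) (L %/ b) %| L %/ x)%N -> (x * gcdn (L %/ a) (L %/ b) %| L)%N.
  by move=> xL h; rewrite -[X in (_ %| X)%N](divnK xL) mulnC dvdn_mul.
rewrite -(dvdn_pmul2r l0) divnK // mulnC muln_lcml dvdn_lcm.
by rewrite !gL ?dvdn_gcdl ?dvdn_gcdr.
Qed.

Lemma codivisor_gcdn a b : (a %| L)%N -> (b %| L)%N ->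
  (L %/ lcmn (L %/ a) (L %/ b))%N = gcdn a b.
Proof.
move=> aL bL; have a0 : (0 < a)%N := dvdn_gt0 (ltn0Sn l) aL; have b0 : (0 < b)%N := dvdn_gt0 (ltn0Sn l) bL.
have cL x : (x %| L)%N -> (L %/ x %| L)%N by move=> xL; rewrite -{2}(divnK xL) dvdn_mulr.
by rewrite -codivisor_lcmn ?cL // !divnA ?cL // !mulKn.
Qed.

(** Solutions of [x + y = c] with [x] in the subgroup of order [a] and [y] in that of order [b]
    exist iff [c] is in the sum of the two. They then form a coset of the intersection, of order
    [gcdn a b]. *)
Lemma mul_Lambda a b c : (a %| L)%N -> (b %| L)%N ->
  gr_mul L (Lambda L a) (Lambda L b) c = (gcdn a b)%:R * Lambda L (lcmn a b) c.
Proof.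
move=> aL bL; rewrite gr_mulE /Lambda.
have cL x : (x %| L)%N -> (L %/ x %| L)%N by move=> xL; rewrite -{2}(divnK xL) dvdn_mulr.
set A := (L %/ a)%N; set B := (L %/ b)%N.
have AL : (A %| L)%N by exact: cL.
have BL : (B %| L)%N by exact: cL.
have modL d x : (d %| L)%N -> (d %| x %% L)%N = (d %| x)%N.
  by move=> dL; rewrite /dvdn modn_dvdm.
have lL : (lcmn a b %| L)%N by rewrite dvdn_lcm aL.
have GL : (gcdn A B %| L)%N by apply: dvdn_trans AL; apply: dvdn_gcdl.
rewrite -codivisor_lcmn // -/A -/B (modL _ _ GL).
have [/dvdnP[k kE] | nGc] := boolP (gcdn A B %| c)%N; last first.
  rewrite mulr0 big1 // => x _; rewrite !(modn_small (ltn_ord _)).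
  case: ifP => Ax; last by rewrite mul0r.
  case: ifP => Bx; last by rewrite mulr0.
  case/negP: nGc; rewrite -(dvdn_inZp c) //.
  rewrite -[inZp c](subrK x) addrC dvdn_ZpD //; last exact: dvdn_trans (dvdn_gcdl _ _) Ax.
  exact: dvdn_trans (dvdn_gcdr _ _) Bx.
have A0 : (0 < A)%N := dvdn_gt0 (ltn0Sn l) AL.
(* Since [A %| gcdn A B + u * B], the point [x0] is a multiple of [A] while [c - x0] is a multiple
   of [B]; it is the base point of the coset. *)
have [u _ uE] := Bezoutl B A0.
pose x0 : 'I_L := inZp (c + k * (u * B)).
have Ax0 : (A %| x0)%N by rewrite dvdn_inZp // kE -mulnDr dvdn_mull.
have Bx0 : (B %| ((inZp c - x0)%R : 'I_L))%N.
  have -> : inZp c - x0 = - inZp (k * (u * B)) :> 'I_L.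
    have -> : x0 = inZp c + inZp (k * (u * B)) by apply: val_inj; rewrite /= modnDm.
    by rewrite opprD addrA subrr add0r.
  by rewrite dvdn_ZpN // dvdn_inZp // mulnA dvdn_mull.
have inj : injective (fun x : 'I_L => x0 + x) by move=> x z /addrI.
rewrite (reindex_inj inj) mulr1 -codivisor_gcdn // -sum_dvdn; last first.
  by rewrite dvdn_lcm AL.
apply: eq_bigr => x _; rewrite dvdn_lcm !(modn_small (ltn_ord _)).
rewrite opprD addrA (dvdn_ZpD _ AL Ax0) (dvdn_ZpD _ BL Bx0) dvdn_ZpN //.
by rewrite -/A -/B; do 2!case: ifP => _ //=; rewrite ?mulr1 ?mulr0.
Qed.

End GroupRing.

(* A pair [(c, t)] in a list stands for [c Lambda_t], and [linext phi] is the
   linear extension of [Lambda_t |-> phi t]. *)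
Definition linext (phi : nat -> rat) (F : seq (rat * nat)) : rat :=
  \sum_(p <- F) p.1 * phi p.2.

Definition lameval (L : nat) (F : seq (rat * nat)) : nat -> rat :=
  fun c => linext (fun t => Lambda L t c) F.

(** The rule of [mul_Lambda], extended bilinearly to formal combinations. *)
Definition lammul (F G : seq (rat * nat)) : seq (rat * nat) :=
  [seq (p.1 * q.1 * (gcdn p.2 q.2)%:R, lcmn p.2 q.2) | p <- F, q <- G].

Definition lamdvd (L : nat) (F : seq (rat * nat)) := all (fun p => p.2 %| L)%N F.

Lemma linext_mul phi F G : linext phi (lammul F G) =
  linext (fun t => linext (fun u => (gcdn t u)%:R * phi (lcmn t u)) G) F.
Proof.
rewrite /linext /lammul big_allpairs_dep /=; apply: eq_bigr => p _.
by rewrite mulr_sumr; apply: eq_bigr => q _; rewrite !mulrA.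
Qed.

Lemma lamdvd_mul L F G : lamdvd L F -> lamdvd L G -> lamdvd L (lammul F G).
Proof.
move=> /allP dF /allP dG; apply/allP => _ /allpairsP[[p q] [pF qG ->]] /=.
by rewrite dvdn_lcm dF // dG.
Qed.

Lemma gr_mul_lameval l F G : lamdvd l.+1 F -> lamdvd l.+1 G ->
  gr_mul l.+1 (lameval l.+1 F) (lameval l.+1 G) = lameval l.+1 (lammul F G).
Proof.
move=> /allP dF /allP dG; apply: functional_extensionality => c.
rewrite /lameval linext_mul gr_mulE /linext.
under eq_bigr => x _ do rewrite big_distrlr.
rewrite exchange_big; apply: eq_big_seq => p /dF pL.
rewrite exchange_big mulr_sumr; apply: eq_big_seq => q /dG qL.
rewrite -mul_Lambda // gr_mulE !mulr_sumr; apply: eq_bigr => x _.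
by rewrite /= mulrACA [RHS]mulrA.
Qed.

Definition num (x : rat) : nat := absz (numq x).
Definition den (x : rat) : nat := absz (denq x).

Definition lamfac (x : rat) : seq (rat * nat) := [:: ((num x)%:R^-1, den x); (-1, 1%N)].

Definition lamprod (xs : seq rat) : seq (rat * nat) :=
  foldr (fun x F => lammul (lamfac x) F) [:: (1, 1%N)] xs.

Lemma lamdvd_prod L xs : all (fun x => den x %| L)%N xs -> lamdvd L (lamprod xs).
Proof.
elim: xs => [|x xs IH] /=; first by rewrite /lamdvd /= dvd1n.
by case/andP=> xL /IH; apply: lamdvd_mul; rewrite /lamdvd /= xL dvd1n.
Qed.

Lemma den_gt0 x : (0 < den x)%N.
Proof. by rewrite absz_gt0 denq_neq0. Qed.

(** * Multiplicities of the divisor [D_w] *)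

Section Divisor.
Variables (n : nat) (w : 'I_n -> rat) (xs : seq rat).
Hypothesis xsP : perm_eq xs [seq w j | j <- enum 'I_n].

Lemma wL_gt0 : (0 < wL w)%N.
Proof. by rewrite prodn_gt0 // => j; apply: den_gt0. Qed.

Lemma den_wL : all (fun x => den x %| wL w)%N xs.
Proof.
rewrite (perm_all _ xsP); apply/allP => _ /mapP[j _ ->].
by rewrite /wL (bigD1 j) //= dvdn_mulr.
Qed.

(** Since the product commutes, [xs] may list the weights in whatever order suits the type. *)
Lemma Dw_lamprod : Dw w = lameval (wL w) (lamprod xs).
Proof.
have dL := den_wL; rewrite /Dw.
have fE j : Dfactor w j = lameval (wL w) (lamfac (w j)).
  apply: functional_extensionality => c; rewrite /Dfactor /lameval /linext !big_cons big_nil /=.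
  by rewrite addr0 mulN1r.
under eq_bigr => j _ do rewrite fE.
have := wL_gt0; case: (wL w) dL => // l dL _.
rewrite -big_enum -(big_map w predT (fun x => lameval l.+1 (lamfac x))) -(perm_big _ xsP).
elim: xs dL => [|x ys IH] /=.
  rewrite big_nil => _; apply: functional_extensionality => c.
  by rewrite /lameval /linext big_seq1 mul1r.
case/andP=> xL ysL; rewrite big_cons IH // gr_mul_lameval //; last exact: lamdvd_prod.
by rewrite /lamdvd /= xL dvd1n.
Qed.

(** The coefficient of [Psi_m], as [Lambda_t] is the sum of the [Psi_m] with [m %| t]. *)
Definition mult (F : seq (rat * nat)) (m : nat) : rat := linext (fun t => (m %| t)%N%:R) F.

Lemma nu_mult m : (m %| wL w)%N -> nu w m = mult (lamprod xs) m.
Proof.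
move=> mL; have L0 := wL_gt0; have m0 := dvdn_gt0 L0 mL.
rewrite /nu m0 mL /= Dw_lamprod /lameval /mult /linext; apply: eq_big_seq => p.
have /allP dF := lamdvd_prod den_wL; move/dF => pL; congr (_ * _); rewrite /Lambda.
have cL x : (x %| wL w)%N -> (wL w %/ x %| wL w)%N by move=> xL; rewrite -{2}(divnK xL) dvdn_mulr.
rewrite {1}/dvdn modn_dvdm ?cL // -/(dvdn _ _).
have -> : (wL w %/ p.2 %| wL w %/ m)%N = (m %| p.2)%N; last by case: ifP.
have p0 := dvdn_gt0 L0 pL; have Lp : (0 < wL w %/ p.2)%N by rewrite divn_gt0 // dvdn_leq.
rewrite -(dvdn_pmul2r m0) (divnK mL) -{2}(divnK pL).
by rewrite dvdn_pmul2l.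
Qed.

Lemma conditions_of_layered t (j : nat) : (1 <= j)%N -> j%:R <= numax w ->
    layered t [pred m | (m %| wL w)%N && (j%:R <= mult (lamprod xs) m)] ->
  condI (Mset w j) /\ strong1 (Mset w j) /\ strong2 (Mset w j).
Proof.
move=> j1 jmax sh; have L0 := wL_gt0.
have MP m : (m \in Mset w j) = (m %| wL w)%N && (j%:R <= mult (lamprod xs) m).
  rewrite mem_filter -dvdn_divisors // andbC.
  by case: (boolP (m %| wL w)%N) => // mL; rewrite nu_mult.
have M0 m : m \in Mset w j -> (0 < m)%N.
  by rewrite MP => /andP[mL _]; apply: dvdn_gt0 mL.
case: sh => [P0 | [T _ sP]]; last exact: spanned_conditions sP.
(* If [M_j] were empty, all values [nu w m] would be below [j], and so would the default [0] of the
   maximum. *)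
suff : numax w < j%:R by rewrite ltNge jmax.
rewrite /numax big_seq; apply: (big_ind (fun x => x < j%:R)).
- by rewrite ltr0n.
- by move=> x y xj yj; rewrite gt_max xj.
move=> m; rewrite -dvdn_divisors // => mL; rewrite nu_mult //.
by have := P0 m; rewrite /= mL /= => /negbT; rewrite -ltNge.
Qed.

End Divisor.

(** ** Divisors of the various types *)

(** The augmentation of the group ring: [Lambda_t] is a sum of [t] roots of unity. *)
Definition deg (F : seq (rat * nat)) : rat := linext (fun t => t%:R) F.

Lemma linext_lamfac phi x F : linext phi (lammul (lamfac x) F) =
  (num x)%:R^-1 * linext (fun u => (gcdn (den x) u)%:R * phi (lcmn (den x) u)) F - linext phi F.
Proof.
rewrite linext_mul {1}/linext !big_cons big_nil addr0 /= mulN1r; congr (_ - _).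
by apply: eq_bigr => q _; rewrite gcd1n lcm1n mul1r.
Qed.

Lemma linext_unit phi : linext phi [:: (1, 1%N)] = phi 1%N.
Proof. by rewrite /linext big_seq1 mul1r. Qed.

(** For [u %| d] one has [Lambda_d Lambda_u = u Lambda_d], so multiplication by [Lambda_d] collapses
    [F] to its degree. *)
Lemma linext_lamfac_dvd phi x F : lamdvd (den x) F ->
  linext phi (lammul (lamfac x) F) = deg F / (num x)%:R * phi (den x) - linext phi F.
Proof.
move=> /allP dF; rewrite linext_lamfac; congr (_ - _).
rewrite /deg /linext !mulr_suml mulr_sumr; apply: eq_big_seq => q /dF /= qd.
have -> : gcdn (den x) q.2 = q.2 by apply/gcdn_idPr.
have -> : lcmn (den x) q.2 = den x by apply/lcmn_idPl.
by ring.
Qed.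

Lemma lamdvd_trans a b F : (a %| b)%N -> lamdvd a F -> lamdvd b F.
Proof. by move=> ab; apply: sub_all => p; move/dvdn_trans; apply. Qed.

Lemma lamdvd_lamfac x F : lamdvd (den x) F -> lamdvd (den x) (lammul (lamfac x) F).
Proof. by move=> dF; apply: lamdvd_mul => //; rewrite /lamdvd /= dvdnn dvd1n. Qed.

Lemma mult_ndvd t F m : lamdvd t F -> ~~ (m %| t)%N -> mult F m = 0.
Proof.
move=> /allP dF mt; rewrite /mult /linext big_seq big1 // => p /dF pt.
have /negPf -> : ~~ (m %| p.2)%N by apply: contra mt => mp; apply: dvdn_trans pt.
by rewrite mulr0.
Qed.

Lemma ratE x : 0 <= x -> x = (num x)%:R / (den x)%:R.
Proof.
move=> x0; rewrite -{1}(divq_num_den x) /num /den.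
have nE : (numq x)%:~R = (absz (numq x))%:R :> rat by rewrite natr_absz ger0_norm // numq_ge0.
have dE : (denq x)%:~R = (absz (denq x))%:R :> rat by rewrite natr_absz ger0_norm // ltW.
by rewrite -nE -dE.
Qed.

Lemma coprime_num_den x : coprime (num x) (den x).
Proof. exact: coprime_num_den. Qed.

Lemma num_gt0 x : 0 < x -> (0 < num x)%N.
Proof. by move=> x0; rewrite absz_gt0 numq_eq0 gt_eqF. Qed.

Lemma num_lt_den x : 0 <= x < 1 -> (num x < den x)%N.
Proof.
case/andP=> x0; rewrite {1}(ratE x0) ltr_pdivrMr ?ltr0n ?den_gt0 //.
by rewrite mul1r ltr_nat.
Qed.

(** * Quasihomogeneity relations and chain type *)

Definition quasi (x y : rat) := exists2 a : nat, (0 < a)%N & a%:R * x + y = 1.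

(** Clearing denominators gives [a * num x * den y = (den y - num y) * den x]. As [den y] is coprime
    to [den y - num y], and [num x] to [den x], both divisibilities follow. *)
Lemma quasi_dvd x y : 0 < x -> 0 <= y < 1 -> quasi x y ->
  [/\ (den y %| den x)%N, (num x %| den y - num y)%N & (num y < den y)%N].
Proof.
move=> x0 y01 [a a0 E]; have ylt := num_lt_den y01; case/andP: y01 => y0 y1.
have nE : (a * num x * den y = (den y - num y) * den x)%N.
  apply/eqP; rewrite -(eqr_nat rat) !natrM natrB ?(ltnW ylt) //; apply/eqP.
  move: E; rewrite {1}(ratE (ltW x0)) {1}(ratE y0) => E.
  have dx : (den x)%:R != 0 :> rat by rewrite pnatr_eq0 -lt0n den_gt0.
  have dy : (den y)%:R != 0 :> rat by rewrite pnatr_eq0 -lt0n den_gt0.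
  have -> : (num y)%:R = (1 - a%:R * ((num x)%:R / (den x)%:R)) * (den y)%:R :> rat.
    by rewrite -[X in X - _]E addrAC subrr add0r divfK.
  by field.
split=> //.
  have : (den y %| (den y - num y) * den x)%N by rewrite -nE dvdn_mull.
  rewrite Gauss_dvdr //; have := coprime_num_den y.
  rewrite -{1 2}(subnK (ltnW ylt)) /coprime gcdnDr gcdnC => /eqP cop.
  by rewrite gcdnC gcdnDl cop.
have : (num x %| (den y - num y) * den x)%N by rewrite -nE -mulnA mulnCA dvdn_mulr.
by rewrite Gauss_dvdl // coprime_num_den.
Qed.

Lemma layered_const t (P : pred nat) (b : bool) :
  (0 < t)%N -> (forall m, P m = (m %| t)%N && b) -> layered t P.
Proof.
move=> t0 PE; apply: layered_up => // [x | x y]; rewrite !PE; first by case/andP.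
by case/andP=> _ -> _ ->.
Qed.

(* The list starts with the last variable of the chain, and the empty tail counts
   as the weight [0 = 0/1], so that the relation [a x + y = 1] is uniform. *)
Fixpoint chainp (xs : seq rat) : Prop :=
  if xs is x :: ys then quasi x (head 0 ys) /\ chainp ys else True.

(* Passing to a longer chain replaces the multiplicity [nu] by [r' - nu] on the
   divisors of the old denominator, so super- and sublevel sets are exchanged. *)
Lemma chain_layers xs (h := head 0 xs) :
    all (fun x => 0 < x < 1) xs -> chainp xs ->
  exists r : rat, [/\ 0 < r, lamdvd (den h) (lamprod xs),
    deg (lamprod xs) = r * (den h - num h)%:R,
    forall m, (m %| den h)%N -> 0 <= mult (lamprod xs) m <= r
  & forall j : rat, layered (den h) [pred m | (m %| den h)%N && (j <= mult (lamprod xs) m)]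
      /\ layered (den h) [pred m | (m %| den h)%N && (mult (lamprod xs) m <= j)]].
Proof.
rewrite {}/h; elim: xs => [_ _ | x ys IH] /=.
  have E m : (m %| 1)%N -> mult [:: (1, 1%N)] m = 1 by rewrite /mult linext_unit => ->.
  exists 1; split => //.
  - by rewrite /deg linext_unit.
  - by move=> m /E ->; rewrite lexx ler01.
  move=> j; split.
    apply: (@layered_const _ _ (j <= 1)) => // m /=.
    by case: (boolP (m %| 1)%N) => // /E ->.
  apply: (@layered_const _ _ (1 <= j)) => // m /=.
  by case: (boolP (m %| 1)%N) => // /E ->.
case/andP=> x01 ys01 [xq /(IH ys01) {IH} [r [r0 dF degF bF layF]]].
set h := head 0 ys in xq dF degF bF layF; set F := lamprod ys in dF degF bF layF *.
have h01 : 0 <= h < 1.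
  by rewrite /h; case: (ys) ys01 => //= z zs /andP[/andP[z0 ->] _]; rewrite ltW.
have x0 : 0 < x by case/andP: x01.
have [hx nx hlt] := quasi_dvd x0 h01 xq.
have dFx : lamdvd (den x) F := lamdvd_trans hx dF.
have nx0 : 0 < (num x)%:R :> rat by rewrite ltr0n num_gt0.
pose r' := deg F / (num x)%:R.
(* Here [num x] divides the positive number [den h - num h], so the new bound is at least the old
   one and [r' - nu] stays between [0] and [r']. *)
have rr' : r <= r'.
  by rewrite /r' ler_pdivlMr // degF ler_pM2l // ler_nat dvdn_leq // subn_gt0.
have mE m : (m %| den x)%N -> mult (lammul (lamfac x) F) m = r' - mult F m.
  by rewrite /mult linext_lamfac_dvd // => ->; rewrite mulr1.
have m0 m : ~~ (m %| den h)%N -> mult F m = 0 by apply: mult_ndvd.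
have b0 m : 0 <= mult F m <= r.
  by have [/bF | /m0 ->] := boolP (m %| den h)%N => //; rewrite lexx ltW.
exists r'; split.
- exact: lt_le_trans rr'.
- exact: lamdvd_lamfac.
- have nlt : (num x <= den x)%N by case/andP: x01 => _ x1; rewrite ltnW // num_lt_den // x1 ltW.
  by rewrite /deg linext_lamfac_dvd // -/(deg F) natrB // mulrBr /r' divfK // gt_eqF.
- by move=> m mx; rewrite mE //; have := b0 m; lra.
have dx0 := den_gt0 x.
move=> j; split.
  have [jr | jr] := ltP r' j.
    apply: (@layered_const _ _ false) => // m /=; case: (boolP (m %| den x)%N) => // mx.
    by rewrite mE // leNgt; have := b0 m; lra.
  (* As [j <= r'], every divisor of [den x] not dividing [den h] qualifies: a full layer over a
     sublevel set of the shorter chain. *)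
  have [_ lay] := layF (r' - j).
  apply: eq_layered (layered_layer dx0 hx lay) => m /=.
  have [mh | mh] := boolP (m %| den h)%N.
    by rewrite andbF (dvdn_trans mh hx) mE ?(dvdn_trans mh hx) //=; apply/idP/idP; lra.
  rewrite andbT orbF; case: (boolP (m %| den x)%N) => // mx.
  by rewrite mE // m0 // subr0 jr.
have [jr | jr] := leP r' j.
  apply: (@layered_const _ _ true) => // m /=; case: (boolP (m %| den x)%N) => // mx.
  by rewrite mE //; have := b0 m; lra.
(* As [j < r'], nothing outside the divisors of [den h] qualifies, which leaves a superlevel set of
   the shorter chain. *)
have [lay _] := layF (r' - j).
apply: eq_layered (layered_dvd hx lay) => m /=.
have [mh | mh] := boolP (m %| den h)%N.
  by rewrite (dvdn_trans mh hx) mE ?(dvdn_trans mh hx) //=; apply/idP/idP; lra.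
case: (boolP (m %| den x)%N) => // mx /=.
by rewrite mE // m0 // subr0 leNgt jr.
Qed.

(** * Cycle type: equal denominators *)

Lemma lamprod_same_den t xs : all (fun x => den x == t) xs ->
  exists c : rat, forall phi, linext phi (lamprod xs) = c * phi t + (-1) ^+ size xs * phi 1%N.
Proof.
elim: xs => [_ | x xs IH] /=; first by exists 0 => phi; rewrite linext_unit mul0r add0r mul1r.
case/andP=> /eqP xt xst; have [c cE] := IH xst.
have dF : lamdvd (den x) (lamprod xs).
  apply: lamdvd_prod; apply/allP => y yxs; rewrite xt.
  by have /allP/(_ y yxs)/eqP -> := xst.
exists (deg (lamprod xs) / (num x)%:R - c) => phi.
by rewrite linext_lamfac_dvd // cE xt exprS; ring.
Qed.

(** On the divisors of [t] the multiplicity is [c], except for [c + e] at [1]. The set consists of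
    all divisors, all but [1], only [1], or none. *)
Lemma cycle_layers L t xs (j : rat) : (0 < t)%N -> (t %| L)%N -> 0 < j ->
    all (fun x => den x == t) xs ->
  layered t [pred m | (m %| L)%N && (j <= mult (lamprod xs) m)].
Proof.
move=> t0 tL j0 xst; have [c cE] := lamprod_same_den xst.
have E m : mult (lamprod xs) m = c * (m %| t)%N%:R + (-1) ^+ size xs * (m == 1%N)%:R.
  by rewrite /mult cE dvdn1.
set e := (-1) ^+ size xs in E.
pose P := [pred m | (m %| t)%N && (j <= c + e * (m == 1%N)%:R)].
apply: (@eq_layered _ P) => [m|] /=.
  rewrite E; have [mt | mt] := boolP (m %| t)%N; first by rewrite (dvdn_trans mt tL) mulr1.
  have [m1 | _] := eqVneq m 1%N; first by rewrite m1 dvd1n in mt.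
  by rewrite /= !mulr0 addr0 leNgt j0 andbF.
have [jc | jc] := leP j c; have [jce | jce] := leP j (c + e).
- apply: (@layered_const _ _ true) => // m /=.
  by case: eqP => _; rewrite ?mulr1 ?mulr0 ?addr0 ?jc ?jce.
- apply: layered_up => // [m | m y] /=; first by case/andP.
  case/andP=> mt jm my yt; rewrite yt /=.
  have [y1 | _] := eqVneq y 1%N; last by rewrite mulr0 addr0.
  by move: my; rewrite y1 dvdn1 => /eqP m1; move: jm; rewrite m1.
- apply: (@layered_dvd 1); first exact: dvd1n.
  apply: (@layered_const _ _ true) => // m /=; rewrite dvdn1 andbT.
  have [-> | _] := eqVneq m 1%N; first by rewrite dvd1n mulr1 jce.
  by rewrite mulr0 addr0 leNgt jc andbF.
- apply: (@layered_const _ _ false) => // m /=.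
  by case: eqP => _; rewrite ?mulr1 ?mulr0 ?addr0 leNgt ?jc ?jce.
Qed.

Lemma layered_extend t L F (j : rat) : (t %| L)%N -> 0 < j -> lamdvd t F ->
  layered t [pred m | (m %| t)%N && (j <= mult F m)] ->
  layered t [pred m | (m %| L)%N && (j <= mult F m)].
Proof.
move=> tL j0 dF; apply: eq_layered => m /=.
have [mt | mt] := boolP (m %| t)%N; first by rewrite (dvdn_trans mt tL).
by rewrite (mult_ndvd dF mt) leNgt j0 /= andbF.
Qed.

(** * Two variables, and the remaining types in three variables *)

Lemma lamdvd_unit t : lamdvd t [:: (1, 1%N)].
Proof. by rewrite /lamdvd /= dvd1n. Qed.

Lemma linext_prod1 phi x : linext phi (lamprod [:: x]) = (num x)%:R^-1 * phi (den x) - phi 1%N.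
Proof. by rewrite /= linext_lamfac_dvd ?lamdvd_unit // /deg !linext_unit div1r. Qed.

Lemma lamdvd_prod1 x : lamdvd (den x) (lamprod [:: x]).
Proof. by apply: lamdvd_prod; rewrite /= dvdnn. Qed.

Lemma quasi0_num x : 0 < x -> quasi x 0 -> num x = 1%N.
Proof.
move=> x0 q0; have [| _ + _] := quasi_dvd x0 _ q0; first by rewrite lexx ltr01.
by rewrite dvdn1 => /eqP.
Qed.

(** If [j] is at most both [Gam - al] and [Gam - be], everything outside the divisors of [gcdn a b]
    forms a full layer. Otherwise no divisor of the gcd qualifies, and elsewhere passing to a
    multiple can only remove negative terms. *)
Lemma layered_two_legs a b (Gam al be j : rat) (N : nat -> rat) :
    (0 < a)%N -> (0 < b)%N -> 1 <= al -> 1 <= be ->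
    (forall m, N m <= 1) ->
    (forall k : rat, layered (gcdn a b) [pred m | (m %| gcdn a b)%N && (k <= N m)]) ->
  layered (lcmn a b) [pred m | (m %| lcmn a b)%N &&
    (j <= Gam - al * (m %| a)%N%:R - be * (m %| b)%N%:R
          + (if (m %| gcdn a b)%N then N m else 0))].
Proof.
move=> a0 b0 al1 be1 N1 layN.
have L0 : (0 < lcmn a b)%N by rewrite lcmn_gt0 a0.
have gL : (gcdn a b %| lcmn a b)%N by rewrite (dvdn_trans (dvdn_gcdl _ _)) ?dvdn_lcml.
have [/andP[ja jb] | jab] := boolP ((j <= Gam - al) && (j <= Gam - be)).
  apply: eq_layered (layered_layer L0 gL (layN (j - Gam + al + be))) => m /=.
  case: (boolP (m %| gcdn a b)%N) => mg /=.
    rewrite (dvdn_trans mg gL) /=; move: mg; rewrite dvdn_gcd => /andP[-> ->].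
    by rewrite !mulr1; apply/idP/idP; lra.
  move: mg; rewrite dvdn_gcd orbF andbT negb_and => mab.
  case: (m %| lcmn a b)%N => //=; symmetry.
  by case: (boolP (m %| a)%N) mab => _; case: (boolP (m %| b)%N) => _ //= _;
     rewrite ?mulr1 ?mulr0; lra.
(* On the gcd the value is at most [Gam - al - be + 1], hence at most each of [Gam - al] and
   [Gam - be], one of which is below [j]. *)
have PE m : (m %| gcdn a b)%N ->
    (j <= Gam - al * (m %| a)%N%:R - be * (m %| b)%N%:R + N m) = false.
  rewrite dvdn_gcd => /andP[-> ->]; rewrite !mulr1; apply/negP => jN.
  by case/negP: jab; have := N1 m; lra.
apply: layered_up => // [m | m y] /=; first by case/andP.
case/andP=> mL jm my yL; rewrite yL /=.
have mg : ~~ (m %| gcdn a b)%N by apply: contraL jm => mg; rewrite mg PE.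
have /negPf yg : ~~ (y %| gcdn a b)%N by apply: contra mg; apply: dvdn_trans.
move: jm; rewrite (negPf mg) yg.
have Hle (c : nat) : (y %| c)%N%:R <= (m %| c)%N%:R :> rat.
  by rewrite ler_nat; case: (boolP (y %| c)%N) => // /(dvdn_trans my) ->.
have Ha : al * (y %| a)%N%:R <= al * (m %| a)%N%:R by rewrite ler_wpM2l ?Hle // (le_trans ler01).
have Hb : be * (y %| b)%N%:R <= be * (m %| b)%N%:R by rewrite ler_wpM2l ?Hle // (le_trans ler01).
by move=> /le_trans; apply; rewrite !addr0 lerD // ?lerD2l lerN2.
Qed.

Lemma layered_one t (k : rat) : (0 < t)%N ->
  layered t [pred m | (m %| t)%N && (k <= (m == 1%N)%:R)].
Proof.
move=> t0; have [k0 | k0] := leP k 0.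
  apply: (@layered_const _ _ true) => // m /=; case: eqP => _; rewrite ?k0 //.
  by rewrite (le_trans k0).
have [k1 | k1] := leP k 1; last first.
  by apply: (@layered_const _ _ false) => // m /=; case: eqP => _; rewrite leNgt ?k0 ?k1.
apply: (@layered_dvd 1); first exact: dvd1n.
apply: (@layered_const _ _ true) => // m /=; rewrite dvdn1 andbT.
by case: eqP => [-> | _]; rewrite ?dvd1n ?k1 // leNgt k0 andbF.
Qed.

Lemma layered_not_one t g (k : rat) : (0 < g)%N -> (t %| g)%N ->
  layered g [pred m | (m %| g)%N && (k <= (m %| t)%N%:R - (m == 1%N)%:R)].
Proof.
move=> g0 tg; have t0 := dvdn_gt0 g0 tg; have [k0 | k0] := leP k 0.
  apply: (@layered_const _ _ true) => // m /=; congr (_ && _).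
  have [-> | _] := eqVneq m 1%N; first by rewrite dvd1n subrr.
  by rewrite subr0 (le_trans k0) ?ler0n.
apply: (layered_dvd tg); apply: layered_up => // [m | m y] /=.
  by have [mt | mt] := boolP (m %| t)%N => //; case/andP=> _; case: eqP => _ /=; lra.
move=> /andP[mg km] my yt; rewrite yt (dvdn_trans yt tg) /=.
move: km; have [m1 | m1] := eqVneq m 1%N; first by rewrite m1 dvd1n; lra.
have [y1 | _] := eqVneq y 1%N; first by move: my m1; rewrite y1 dvdn1 => /eqP ->.
by rewrite (dvdn_trans my yt).
Qed.

(** Both numerators are [1], and the product is [gcd(a,b) Lambda_lcm(a,b) - Lambda_a - Lambda_b +
    Lambda_1]: two legs with [Lambda_1] on the gcd. *)
Lemma fermat_layers L x y (j : rat) : 0 < x -> 0 < y -> quasi x 0 -> quasi y 0 ->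
    0 < j -> (den x %| L)%N -> (den y %| L)%N ->
  exists t, layered t [pred m | (m %| L)%N && (j <= mult (lamprod [:: x; y]) m)].
Proof.
move=> x0 y0 /(quasi0_num x0) nx /(quasi0_num y0) ny j0 xL yL.
have a0 := den_gt0 x; have b0 := den_gt0 y.
set a := den x in xL a0 *; set b := den y in yL b0 *.
have abL : (lcmn a b %| L)%N by rewrite dvdn_lcm xL.
exists (lcmn a b); apply: layered_extend => //.
  by apply: lamdvd_prod; rewrite /= dvdn_lcml dvdn_lcmr.
apply: (@eq_layered _ [pred m | (m %| lcmn a b)%N &&
    (j <= (gcdn a b)%:R - 1 * (m %| a)%N%:R - 1 * (m %| b)%N%:R
          + (if (m %| gcdn a b)%N then (m == 1%N)%:R else 0))]).
  move=> m /=; case mab: (m %| lcmn a b)%N => //=; congr (_ <= _).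
  have -> : mult (lamprod [:: x; y]) m = (gcdn a b)%:R - 1 * (m %| a)%N%:R
              - 1 * (m %| b)%N%:R + (m == 1%N)%:R.
    rewrite /mult [lamprod _]/= linext_lamfac -/(lamprod [:: y]) !linext_prod1 nx ny invr1 -/a -/b.
    by rewrite mab gcdn1 lcmn1 dvdn1 /= /=; ring.
  by case: ifP => //; case: eqP => // ->; rewrite dvd1n.
apply: layered_two_legs => // [m | k]; first by case: eqP.
by apply: layered_one; rewrite gcdn_gt0 a0.
Qed.

Lemma typeIII_layers L x1 x2 x3 (j : rat) :
    all (fun x => 0 < x < 1) [:: x1; x2; x3] ->
    quasi x1 0 -> quasi x2 x1 -> quasi x3 x1 ->
    0 < j -> (den x2 %| L)%N -> (den x3 %| L)%N ->
  exists t, layered t [pred m | (m %| L)%N && (j <= mult (lamprod [:: x2; x3; x1]) m)].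
Proof.
case/and4P=> x101 /andP[x20 _] /andP[x30 _] _ q1 q2 q3 j0 x2L x3L.
have x10 : 0 < x1 by case/andP: x101.
have x101' : 0 <= x1 < 1 by case/andP: x101 => /ltW -> ->.
have n1 := quasi0_num x10 q1.
have [t12 s2 t1gt] := quasi_dvd x20 x101' q2; have [t13 s3 _] := quasi_dvd x30 x101' q3.
rewrite n1 in s2 s3 t1gt.
have a0 := den_gt0 x2; have b0 := den_gt0 x3; have t10 := den_gt0 x1.
set t1 := den x1 in t12 t13 s2 s3 t1gt t10 *.
set a := den x2 in x2L t12 a0 *; set b := den x3 in x3L t13 b0 *.
have abL : (lcmn a b %| L)%N by rewrite dvdn_lcm x2L.
exists (lcmn a b); apply: layered_extend => //.
  by apply: lamdvd_prod; rewrite /= dvdn_lcml dvdn_lcmr (dvdn_trans t12) ?dvdn_lcml.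
(* These are the degree [t1 - 1] of [Lambda_t1 - Lambda_1] divided by the numerators. Both are at
   least [1] because the numerators divide [t1 - 1], so two legs apply with [Lambda_t1 - Lambda_1]
   on the gcd. *)
pose al : rat := (t1%:R - 1) / (num x2)%:R; pose be : rat := (t1%:R - 1) / (num x3)%:R.
have quo1 x : 0 < x -> (num x %| t1 - 1)%N -> 1 <= (t1%:R - 1) / (num x)%:R :> rat.
  move=> xp sx; have -> : t1%:R - 1 = (t1 - 1)%:R :> rat by rewrite natrB // ltnW.
  rewrite ler_pdivlMr ?ltr0n ?num_gt0 // mul1r ler_nat.
  by rewrite dvdn_leq // subn_gt0.
pose Gam : rat := (num x2)%:R^-1 * be * (gcdn a b)%:R.
have ME m : (m %| lcmn a b)%N -> mult (lamprod [:: x2; x3; x1]) m =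
    Gam - al * (m %| a)%N%:R - be * (m %| b)%N%:R + ((m %| t1)%N%:R - (m == 1%N)%:R).
  move=> mab; rewrite /mult [lamprod _]/= linext_lamfac -/(lamprod [:: x1]).
  have dF : lamdvd (den x3) (lamprod [:: x1]) := lamdvd_trans t13 (lamdvd_prod1 x1).
  rewrite 2!(linext_lamfac_dvd _ dF) /deg !linext_prod1 n1 invr1 -/t1 -/a -/b.
  have -> : gcdn a t1 = t1 by apply/gcdn_idPr.
  have -> : lcmn a t1 = a by apply/lcmn_idPl.
  by rewrite mab gcdn1 lcmn1 dvdn1 /Gam /al /be /=; ring.
have t1g : (t1 %| gcdn a b)%N by rewrite dvdn_gcd t12.
apply: (@eq_layered _ [pred m | (m %| lcmn a b)%N &&
    (j <= Gam - al * (m %| a)%N%:R - be * (m %| b)%N%:R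
          + (if (m %| gcdn a b)%N then (m %| t1)%N%:R - (m == 1%N)%:R else 0))]).
  move=> m /=; case mab: (m %| lcmn a b)%N => //=; rewrite ME //; congr (_ <= _ + _).
  case: ifP => // mg; have [mt | mt] := boolP (m %| t1)%N.
    by rewrite (dvdn_trans mt t1g) in mg.
  have [m1 | _] := eqVneq m 1%N; last by rewrite subr0.
  by rewrite m1 dvd1n in mt.
apply: layered_two_legs => // [||m|k]; [exact: quo1 | exact: quo1 | |].
  by case: (m %| t1)%N; case: (m == 1%N) => /=; lra.
by apply: layered_not_one => //; rewrite gcdn_gt0 a0.
Qed.

(** The denominators divide each other. The coefficient [c] is nonnegative because [num y] divides
    [den x - num x], which is positive. *)
Lemma lamprod_cycle2 x y : 0 < x < 1 -> 0 < y < 1 -> quasi x y -> quasi y x ->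
  exists c : rat, [/\ 0 <= c, den y = den x, lamdvd (den x) (lamprod [:: x; y]) &
    forall phi, linext phi (lamprod [:: x; y]) = c * phi (den x) + phi 1%N].
Proof.
move=> /andP[x0 x1] /andP[y0 y1] qx qy.
have [| dyx _ _] := quasi_dvd x0 _ qx; first by rewrite y1 ltW.
have [| dxy nyx nlt] := quasi_dvd y0 _ qy; first by rewrite x1 ltW.
have dE : den y = den x by apply/eqP; rewrite eqn_dvd dyx.
have nx0 : 0 < (num x)%:R :> rat by rewrite ltr0n num_gt0.
have ny0 : 0 < (num y)%:R :> rat by rewrite ltr0n num_gt0.
have dF : lamdvd (den x) (lamprod [:: y]) := lamdvd_trans dyx (lamdvd_prod1 y).
exists (((den x)%:R - (num y)%:R - (num x)%:R) / ((num x)%:R * (num y)%:R)); split => //.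
- apply: divr_ge0; last by apply: mulr_ge0; apply: ltW.
  rewrite -addrA -opprD subr_ge0 -natrD ler_nat.
  by have := dvdn_leq _ nyx; rewrite subn_gt0 => /(_ nlt); lia.
- exact: lamdvd_lamfac.
- move=> phi; rewrite [lamprod _]/= -/(lamprod [:: y]) (linext_lamfac_dvd _ dF) /deg !linext_prod1 dE.
  by field; rewrite !gt_eqF.
Qed.

Lemma typeIV_layers L x1 x2 x3 (j : rat) :
    all (fun x => 0 < x < 1) [:: x1; x2; x3] ->
    quasi x1 0 -> quasi x2 x3 -> quasi x3 x2 ->
    0 < j -> (den x1 %| L)%N -> (den x2 %| L)%N ->
  exists t, layered t [pred m | (m %| L)%N && (j <= mult (lamprod [:: x1; x2; x3]) m)].
Proof.
case/and4P=> /andP[x10 _] x201 x301 _ q1 q2 q3 j0 x1L x2L.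
have n1 := quasi0_num x10 q1.
have [c [c0 _ dF cE]] := lamprod_cycle2 x201 x301 q2 q3.
have a0 := den_gt0 x1; have b0 := den_gt0 x2.
set t1 := den x1 in x1L a0; set t := den x2 in x2L dF cE b0.
have LL : (lcmn t1 t %| L)%N by rewrite dvdn_lcm x1L.
have L0 : (0 < lcmn t1 t)%N by rewrite lcmn_gt0 a0.
have g0 : (0 < gcdn t1 t)%N by rewrite gcdn_gt0 a0.
have tL : (t %| lcmn t1 t)%N := dvdn_lcmr _ _.
have gt : (gcdn t1 t %| t)%N := dvdn_gcdr _ _.
have t1L : (t1 %| lcmn t1 t)%N := dvdn_lcml _ _.
pose cg : rat := c * (gcdn t1 t)%:R.
have ME m : (m %| lcmn t1 t)%N -> mult (lamprod [:: x1; x2; x3]) m =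
    cg - c * (m %| t)%N%:R + (m %| t1)%N%:R - (m == 1%N)%:R.
  move=> mab; rewrite /mult [lamprod _]/= linext_lamfac -/(lamprod [:: x2; x3]) !cE n1 invr1 -/t1 -/t.
  by rewrite mab gcdn1 lcmn1 dvdn1 /cg /=; ring.
exists (lcmn t1 t); apply: layered_extend => //.
  rewrite [lamprod _]/=; apply: lamdvd_mul; last exact: lamdvd_trans dF.
  by rewrite /lamdvd /= -/t1 t1L dvd1n.
apply: (@eq_layered _ [pred m | (m %| lcmn t1 t)%N &&
    (j <= cg - c * (m %| t)%N%:R + (m %| t1)%N%:R - (m == 1%N)%:R)]).
  by move=> m /=; case mab: (m %| lcmn t1 t)%N => //=; rewrite ME.
(* For [j <= cg] all numbers not dividing [t] form a full layer, over a set described by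
   [gcdn t1 t]. For [j > cg] only divisors of [t1] qualify, since [c >= 0], and [1] never does. *)
have [jcg | jcg] := leP j cg.
  have lay : layered t [pred m | (m %| t)%N &&
      (j - cg + c <= (m %| gcdn t1 t)%N%:R - (m == 1%N)%:R)].
    by apply: layered_not_one.
  apply: eq_layered (layered_layer L0 tL lay) => m /=.
  have [mt | mt] := boolP (m %| t)%N.
    rewrite (dvdn_trans mt tL) dvdn_gcd mt andbT mulr1 /=.
    by apply/idP/idP; lra.
  rewrite andbT orbF mulr0 subr0; have [m1 | _] := eqVneq m 1%N; first by rewrite m1 dvd1n in mt.
  case: (m %| lcmn t1 t)%N => //=; symmetry.
  by case: (m %| t1)%N => /=; lra.
apply: (layered_dvd t1L); apply: layered_up => // [m | m y] /=.
  case/andP=> _; have [// | _] := boolP (m %| t1)%N.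
  by case: (m %| t)%N; case: (m == 1%N) => /=; rewrite ?mulr1 ?mulr0; lra.
move=> /andP[mL jm] my yt1; rewrite (dvdn_trans yt1 t1L) yt1 /=.
move: jm; rewrite (dvdn_trans my yt1).
have [-> | m1] := eqVneq m 1%N; first by rewrite dvd1n /=; lra.
have [y1 | _] := eqVneq y 1%N; first by move: my m1; rewrite y1 dvdn1 => /eqP ->.
have [yt | _] := boolP (y %| t)%N; first by rewrite (dvdn_trans my yt).
by case: (m %| t)%N; rewrite /= ?mulr1 ?mulr0; lra.
Qed.

(** All denominators divide [den x3], so one positive multiple of [Lambda] for [den x3] remains, and
    the subtracted terms do not grow along multiples. *)
Lemma typeVI_layers L x1 x2 x3 (j : rat) :
    all (fun x => 0 < x < 1) [:: x1; x2; x3] ->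
    quasi x1 x2 -> quasi x2 x1 -> quasi x3 x1 ->
    0 < j -> (den x3 %| L)%N ->
  exists t, layered t [pred m | (m %| L)%N && (j <= mult (lamprod [:: x3; x1; x2]) m)].
Proof.
case/and4P=> x101 x201 /andP[x30 _] _ q1 q2 q3 j0 x3L.
have [c [c0 _ dF cE]] := lamprod_cycle2 x101 x201 q1 q2.
have [| tt3 _ _] := quasi_dvd x30 _ q3; first by case/andP: x101 => /ltW -> ->.
have dF3 := lamdvd_trans tt3 dF.
exists (den x3); apply: layered_extend => //; first exact: lamdvd_lamfac.
pose Gam : rat := deg (lamprod [:: x1; x2]) / (num x3)%:R.
have ME m : (m %| den x3)%N -> mult (lamprod [:: x3; x1; x2]) m =
    Gam - c * (m %| den x1)%N%:R - (m %| 1)%N%:R.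
  by move=> mt; rewrite /mult [lamprod _]/= -/(lamprod [:: x1; x2]) (linext_lamfac_dvd _ dF3) -/Gam cE mt mulr1; ring.
apply: layered_up => [|m | m y] /=; first exact: den_gt0.
  by case/andP.
case/andP=> mt + my yt; rewrite !ME // yt /= => /le_trans; apply.
have Hle (d : nat) : (y %| d)%N%:R <= (m %| d)%N%:R :> rat.
  by rewrite ler_nat; case: (boolP (y %| d)%N) => // /(dvdn_trans my) ->.
by rewrite lerD ?lerD2l // lerN2 ?ler_wpM2l ?Hle.
Qed.

(** ** The weight systems of the theorem *)

Lemma wnE n (v : 'I_n -> rat) (i : 'I_n) : wn v i = v i.
Proof. by rewrite /wn valK. Qed.

Lemma perm_wn n (w : 'I_n -> rat) (s : {perm 'I_n}) :
  perm_eq [seq wn (fun i => w (s i)) k | k <- iota 0 n] [seq w j | j <- enum 'I_n].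
Proof.
rewrite -val_enum_ord -map_comp.
rewrite (eq_map (_ : _ =1 w \o s)); last by move=> i; rewrite /= wnE.
rewrite map_comp; apply: perm_map; apply: uniq_perm; rewrite ?enum_uniq //.
  by rewrite map_inj_uniq ?enum_uniq //; apply: perm_inj.
move=> i; rewrite mem_enum; apply/mapP; exists (s^-1%g i); rewrite ?mem_enum //.
by rewrite permKV.
Qed.

Lemma chain_list n (v : 'I_n -> rat) (a : 'I_n -> nat) :
    (forall j, 0 < a j)%N ->
    (forall j : 'I_n, val j = 0%N -> (a j)%:R * v j = 1) ->
    (forall i j : 'I_n, (i.+1)%N = j -> (a j)%:R * v j + v i = 1) ->
  chainp (rev [seq wn v k | k <- iota 0 n]).
Proof.
move=> a0 vb vs; suff h k : (k <= n)%N -> chainp (rev [seq wn v i | i <- iota 0 k]) by apply: h.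
elim: k => [|k IH] kn //; have kn' := ltnW kn.
rewrite -addn1 iotaD map_cat rev_cat /= add0n; split; last exact: IH.
exists (a (Ordinal kn)) => //; rewrite -[X in wn v X]/(val (Ordinal kn)) wnE.
case: k {IH} kn kn' => [|k] kn kn'; first by rewrite /= addr0 vb.
have -> : iota 0 k.+1 = iota 0 k ++ [:: k] by rewrite -addn1 iotaD.
rewrite map_cat rev_cat /=.
by rewrite -[X in wn v X]/(val (Ordinal kn')) wnE; apply: vs.
Qed.

Lemma cycle_den n (v : 'I_n -> rat) (a : 'I_n -> nat) :
    (forall i, 0 < v i < 1) -> (forall j, 0 < a j)%N ->
    (forall i j : 'I_n, (i.+1 %% n)%N = j -> (a j)%:R * v j + v i = 1) ->
  forall i j, den (v i) = den (v j).
Proof.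
move=> v01 a0 vs.
have step (i j : 'I_n) : (i.+1 %% n)%N = j -> (den (v i) %| den (v j))%N.
  move=> /vs q; have /andP[vj0 _] := v01 j; have /andP[vi0 vi1] := v01 i.
  have [||//] := @quasi_dvd (v j) (v i) vj0; first by rewrite ltW.
  by exists (a j).
suff dv (i : 'I_n) k (j : 'I_n) : ((i + k) %% n)%N = j -> (den (v i) %| den (v j))%N.
  move=> i j; apply/eqP; rewrite eqn_dvd.
  (* Going forward around the cycle, [n - i + j] steps lead from [i] to [j]. *)
  rewrite (dv i (n - i + j)%N) ?(dv j (n - j + i)%N) //.
    by rewrite addnA subnKC 1?ltnW // modnDl modn_small.
  by rewrite addnA subnKC 1?ltnW // modnDl modn_small.
elim: k j => [|k IH] j.
  by rewrite addn0 modn_small // => /val_inj ->.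
have n0 : (0 < n)%N := leq_ltn_trans (leq0n i) (ltn_ord i).
pose j' := Ordinal (ltn_pmod (i + k) n0).
move=> E; apply: dvdn_trans (IH j' erefl) _; apply: step.
by rewrite -E /= addnS -addn1 modnDml addn1.
Qed.

(** Condition [C1] for the set [{i}]: in its second alternative [K] has one element outside [{i}],
    which must be [k]. *)
Lemma C1_singleton (w : 'I_2 -> rat) (i k : 'I_2) :
  weight_range w -> C1 w -> i != k -> quasi (w i) 0 \/ quasi (w i) (w k).
Proof.
move=> w01 c1 ik; have /andP[wk0 wk1] := w01 k.
have ws al : supported_on [set i] al -> wsum w al = (al i)%:R * w i.
  move=> sal; rewrite /wsum (bigD1 i) //= big1 ?addr0 // => l li.
  by rewrite sal ?mul0r // inE.
have pos al (x : rat) : x != 0 -> (al i)%:R * w i = x -> (0 < al i)%N.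
  by move=> x0 E; rewrite lt0n; apply: contraNneq x0 => a0; rewrite -E a0 mul0r.
have [|[al [sal E]]|[K [KJ [cK hK]]]] := c1 [set i].
- by apply/set0Pn; exists i; rewrite inE.
- left; rewrite ws // in E; exists (al i); last by rewrite addr0.
  by apply: pos E; rewrite oner_neq0.
have /eqP/cards1P[l Kl] : #|K| = 1%N by rewrite cK cards1.
have lE : l = k.
  have : l \in ~: [set i] by apply: (subsetP KJ); rewrite Kl inE.
  by rewrite !inE; case: i k l ik {w01 c1 ws pos wk0 wk1 KJ cK hK Kl} => -[|[|//]] ? [[|[|//]] ?] [[|[|//]] ?] // _ _; apply: val_inj.
have [|al [sal E]] := hK k; first by rewrite Kl lE inE.
rewrite ws // in E; right; exists (al i); last by rewrite E subrK.
by apply: pos E; rewrite subr_eq0 gt_eqF.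
Qed.

Lemma layered_exists n (w : 'I_n -> rat) : weight_range w -> C1 w ->
  (cycle_type w \/ chain_type w \/ n = 2%N \/
   (n = 3%N /\ (typeIII w \/ typeIV w \/ typeV w \/ typeVI w \/ typeVII w))) ->
  exists2 xs, perm_eq xs [seq w j | j <- enum 'I_n] &
    forall j : rat, 0 < j ->
      exists t, layered t [pred m | (m %| wL w)%N && (j <= mult (lamprod xs) m)].
Proof.
move=> w01 c1.
have xs01 xs : perm_eq xs [seq w j | j <- enum 'I_n] -> all (fun x => 0 < x < 1) xs.
  by move=> xsP; rewrite (perm_all _ xsP); apply/allP => _ /mapP[i _ ->]; apply: w01.
have dL xs x : perm_eq xs [seq w j | j <- enum 'I_n] -> x \in xs -> (den x %| wL w)%N.
  by move=> xsP; have /allP := den_wL xsP; apply.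
have cyc : cycle_type w -> exists2 xs, perm_eq xs [seq w j | j <- enum 'I_n] &
    forall j : rat, 0 < j ->
      exists t, layered t [pred m | (m %| wL w)%N && (j <= mult (lamprod xs) m)].
  case=> s [a [a0 E]]; exists [seq wn (fun i => w (s i)) k | k <- iota 0 n].
    exact: perm_wn.
  move=> j j0; have xsP := perm_wn w s; set xs := map _ _ in xsP *.
  have dE := cycle_den (fun i => w01 (s i)) a0 E.
  have [t [t0 tL xst]] : exists t, [/\ (0 < t)%N, (t %| wL w)%N & all (fun x => den x == t) xs].
    have xsE : xs = [seq w (s i) | i <- enum 'I_n].
      rewrite /xs -val_enum_ord -map_comp; apply: eq_map => i; exact: wnE.
    case: (pickP 'I_n) => [i _ | no].
      exists (den (w (s i))); split; first exact: den_gt0.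
        by apply: dL xsP _; rewrite xsE; apply/mapP; exists i; rewrite ?mem_enum.
      by apply/allP => x; rewrite xsE => /mapP[k _ ->]; apply/eqP/dE.
    (* Without variables any positive divisor serves. *)
    exists 1%N; split => //.
    by apply/allP => x; rewrite xsE => /mapP[k _ _]; have := no k.
  by exists t; apply: cycle_layers.
have lay_chain xs : perm_eq xs [seq w j | j <- enum 'I_n] -> chainp xs -> forall j : rat, 0 < j ->
      exists t, layered t [pred m | (m %| wL w)%N && (j <= mult (lamprod xs) m)].
  move=> xsP ch j j0; have [r [_ dF _ _ lay]] := chain_layers (xs01 xs xsP) ch.
  exists (den (head 0 xs)); apply: layered_extend => //; last by have [] := lay j.
  case: (xs) xsP => [_ | x ys xsP]; first exact: dvd1n.
  by apply: dL xsP _; rewrite mem_head.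
have chn : chain_type w -> exists2 xs, perm_eq xs [seq w j | j <- enum 'I_n] &
    forall j : rat, 0 < j ->
      exists t, layered t [pred m | (m %| wL w)%N && (j <= mult (lamprod xs) m)].
  case=> s [a [a0 [Eb E]]].
  have xsP : perm_eq (rev [seq wn (fun i => w (s i)) k | k <- iota 0 n]) [seq w j | j <- enum 'I_n].
    by rewrite perm_rev; apply: perm_wn.
  by eexists; [exact: xsP | apply: lay_chain => //; apply: chain_list E].
case=> [/cyc // | [/chn // | [n2 | [n3 ty]]]].
  clear cyc chn; subst n.
  have o01 : (ord0 : 'I_2) != ord_max by [].
  have o10 : (ord_max : 'I_2) != ord0 by [].
  have xsP : perm_eq [:: w ord0; w ord_max] [seq w j | j <- enum 'I_2].
    rewrite enum_ordSl enum_ordSl; have -> : enum 'I_0 = [::] by apply/size0nil; rewrite size_enum_ord.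
    by rewrite /= (_ : lift ord0 ord0 = ord_max) //; apply: val_inj.
  have xsP' : perm_eq [:: w ord_max; w ord0] [seq w j | j <- enum 'I_2].
    by rewrite -(perm_rot 1).
  have /andP[x0 _] := w01 ord0; have /andP[y0 _] := w01 ord_max.
  (* Two relations without a second variable give the Fermat product, exactly one gives a chain in
     one of the two orders, and none gives a cycle. *)
  have [qx | qx] := C1_singleton w01 c1 o01;
  have [qy | qy] := C1_singleton w01 c1 o10.
  - exists [:: w ord0; w ord_max] => // j j0; apply: fermat_layers => //.
      by apply: dL xsP _; rewrite mem_head.
    by apply: dL xsP _; rewrite !inE eqxx orbT.
  - by exists [:: w ord_max; w ord0] => //; apply: lay_chain.
  - by exists [:: w ord0; w ord_max] => //; apply: lay_chain.
  exists [:: w ord0; w ord_max] => // j j0; exists (den (w ord0)); apply: cycle_layers => //.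
  - exact: den_gt0.
  - by apply: dL xsP _; rewrite mem_head.
  have [c [_ dE _ _]] := lamprod_cycle2 (w01 ord0) (w01 ord_max) qx qy.
  by rewrite /= dE eqxx.
case: ty => [ty | [ty | [/chn // | [ty | /cyc //]]]]; clear cyc chn; subst n;
  case: ty => s [a1 [a2 [a3 [/andP[/andP[a10 a20] a30] E1 E2 E3]]]];
  have := perm_wn w s; set v := wn _ in E1 E2 E3 *; rewrite /= => xsP;
  have v01 := xs01 _ xsP.
(* The head of the list is multiplied last, so the weight [v 0%N], whose denominator divides the
   others, is moved to the end. *)
- have xsP' : perm_eq [:: v 1%N; v 2%N; v 0%N] [seq w j | j <- enum 'I_3].
    by rewrite -(perm_rot 2).
  exists [:: v 1%N; v 2%N; v 0%N] => // j j0; apply: typeIII_layers => //.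
  + by exists a1; rewrite ?addr0.
  + by exists a2.
  + by exists a3.
  + by apply: dL xsP _; rewrite !inE eqxx orbT.
  + by apply: dL xsP _; rewrite !inE eqxx !orbT.
- exists [:: v 0%N; v 1%N; v 2%N] => // j j0; apply: typeIV_layers => //.
  + by exists a1; rewrite ?addr0.
  + by exists a2.
  + by exists a3.
  + by apply: dL xsP _; rewrite !inE eqxx.
  + by apply: dL xsP _; rewrite !inE eqxx orbT.
- have xsP' : perm_eq [:: v 2%N; v 0%N; v 1%N] [seq w j | j <- enum 'I_3].
    by rewrite -(perm_rot 1).
  exists [:: v 2%N; v 0%N; v 1%N] => // j j0; apply: typeVI_layers => //.
  + by exists a1.
  + by exists a2.
  + by exists a3.
  + by apply: dL xsP _; rewrite !inE eqxx !orbT.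
Qed.

Theorem theorem6p9 (n : nat) (w : 'I_n -> rat) :
  weight_range w -> C1 w ->
  (cycle_type w \/ chain_type w \/ n = 2%N \/
   (n = 3%N /\ (typeIII w \/ typeIV w \/ typeV w \/ typeVI w \/ typeVII w))) ->
  forall j : nat, (1 <= j)%N -> j%:R <= numax w ->
    condI (Mset w j) /\ strong1 (Mset w j) /\ strong2 (Mset w j).
Proof.
move=> w01 c1 ty j j1 jmax.
have [xs xsP lay] := layered_exists w01 c1 ty.
have [|t layt] := lay j%:R; first by rewrite ltr0n.
exact: (conditions_of_layered xsP j1 jmax layt).
Qed.
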